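(* Let $\lambda$ and $\nu$ be balanced partitions such that the Young diagram of $\nu$ is contained in the Young diagram of $\lambda$. Let $(\alpha,\beta)$ be the 2-quotient of $\lambda$. Then $$\frac{\chi^\lambda(\nu,2,2,\dots,2)}{\chi^\lambda(2,2,\dots,2)}=\frac{\left(\frac{|\lambda|-|\nu|}{2}\right)!}{\left(\frac{|\lambda|}{2}\right)!}\sum_{\mu}\sigma_\mu\,\chi^\mu(\nu)\,\mathbf s_a(\alpha)\,\mathbf s_b(\beta),$$ where the sum runs over all balanced partitions $\mu$ with $|\mu|=|\nu|$ whose Young diagram is contained in the Young diagram of $\lambda$, and $(a,b)$ denotes the 2-quotient of $\mu$.
   Context: Characters. For a partition $\lambda$ of $n$, $\chi^\lambda$ is the character of the irreducible representation of the symmetric group $S(n)$ indexed by $\lambda$ (with $(n)$ giving the trivial representation), and $\chi^\lambda(\eta)$ is its value on permutations of cycle type $\eta$. $(\nu,2,\dots,2)$ is $\nu$ completed by parts equal to $2$ to a partition of $|\lambda|$; $(2,\dots,2)$ is the partition of $|\lambda|$ with all parts equal to 2 ($\chi^\lambda(2,\dots,2)\ne0$ for balanced $\lambda$). Balanced partitions and 2-quotients. A partition is balanced if its Young diagram can be obtained from the empty one by successively adding dominoes (pairs of adjacent cells), each intermediate shape being a Young diagram. For a partition $\lambda=(\lambda_1\ge\lambda_2\ge\dots)$ (extended by zeros) let $M(\lambda)=\{\lambda_i-i+\tfrac12: i\ge1\}\subset\mathbb Z+\tfrac12$. For $\lambda$ balanced, its 2-quotient is the pair of partitions $(\alpha,\beta)$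 determined by $M(\alpha)=\{(x+\tfrac12)/2: x\in M(\lambda)\cap(2\mathbb Z+\tfrac12)\}$ and $M(\beta)=\{(x-\tfrac12)/2: x\in M(\lambda)\cap(2\mathbb Z-\tfrac12)\}$; one has $|\alpha|+|\beta|=|\lambda|/2$. Sign. For balanced $\mu$, $\sigma_\mu=(-1)^{o/2}$, where $o$ (necessarily even) is the number of odd parts of $\mu$. Shifted Schur functions. With $(x\downharpoonright k)=x(x-1)\cdots(x-k+1)$, $$\mathbf s_\mu(x_1,\dots,x_n)=\frac{\det[(x_i+n-i\downharpoonright\mu_j+n-j)]_{1\le i,j\le n}}{\det[(x_i+n-i\downharpoonright n-j)]_{1\le i,j\le n}}\qquad(n\ge\ell(\mu)),$$ which satisfies $\mathbf s_\mu(x_1,\dots,x_n,0)=\mathbf s_\mu(x_1,\dots,x_n)$; for a partition $\alpha$, $\mathbf s_\mu(\alpha)=\mathbf s_\mu(\alpha_1,\dots,\alpha_n)$ for any $n\ge\max(\ell(\mu),\ell(\alpha))$. *)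

(* Defs.v *)
From HB Require Import structures.
From mathcomp Require Import all_boot all_order all_algebra all_fingroup.
From mathcomp Require Import all_field all_character.
From mathcomp Require Import boolp classical_sets fsbigop.

Set Implicit Arguments.
Unset Strict Implicit.
Unset Printing Implicit Defensive.

Import GRing.Theory.

Local Open Scope ring_scope.

(* Partitions are weakly decreasing sequences of positive integers, so that    *)
(* each partition has exactly one representation and its length is [size].     *)
Definition is_part (lam : seq nat) : bool := sorted geq lam && (0%N \notin lam).

(* Cells are (row, column), both counted from 0. *)
Definition in_diagram (lam : seq nat) (c : nat * nat) : bool :=
  (c.2 < nth 0%N lam c.1)%N.

Definition diagram_sub (mu lam : seq nat) : Prop :=
  forall c, in_diagram mu c -> in_diagram lam c.

Definition adjacent (c d : nat * nat) : Prop :=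
  d = (c.1, c.2.+1) \/ d = (c.1.+1, c.2).

Definition adds_domino (mu lam : seq nat) : Prop :=
  exists c d, [/\ adjacent c d, ~~ in_diagram mu c, ~~ in_diagram mu d &
    forall x, in_diagram lam x = [|| in_diagram mu x, x == c | x == d]].

Inductive balanced : seq nat -> Prop :=
| balanced_nil : balanced [::]
| balanced_domino mu lam :
    balanced mu -> is_part lam -> adds_domino mu lam -> balanced lam.

Definition maya (lam : seq nat) : set rat :=
  [set x | exists i : nat, x = (nth 0%N lam i)%:R - i.+1%:R + 2^-1]%classic.

Definition is_two_quotient (lam : seq nat) (ab : seq nat * seq nat) : Prop :=
  [/\ is_part ab.1, is_part ab.2,
      maya ab.1 = [set (x + 2^-1) / 2 | x in
        maya lam `&` [set x | exists k : int, x = 2 * k%:~R + 2^-1]]%classic &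
      maya ab.2 = [set (x - 2^-1) / 2 | x in
        maya lam `&` [set x | exists k : int, x = 2 * k%:~R - 2^-1]]%classic].

(* The pair singled out by [is_two_quotient]; the default value is irrelevant  *)
(* for balanced partitions, for which that pair exists and is unique.          *)
Definition two_quotient (lam : seq nat) : seq nat * seq nat :=
  xget ([::], [::]) [set ab | is_two_quotient lam ab]%classic.

Definition sigma (mu : seq nat) : algC := (-1) ^+ (count odd mu)./2.

Definition falling (R : pzRingType) (x : R) (k : nat) : R :=
  \prod_(i < k) (x - i%:R).

(* With 0-based indices, the shift n - i becomes n - i.+1. *)
Definition shifted_schur (F : fieldType) (mu : seq nat) (n : nat)
    (x : 'I_n -> F) : F :=
  \det (\matrix_(i < n, j < n)
          falling (x i + (n - i.+1)%:R) (nth 0%N mu j + (n - j.+1)))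
  / \det (\matrix_(i < n, j < n) falling (x i + (n - i.+1)%:R) (n - j.+1)).

Definition shifted_schur_part (mu al : seq nat) : algC :=
  shifted_schur mu (fun i : 'I_(maxn (size mu) (size al)) => (nth 0%N al i)%:R).

(* The cells of lam are numbered by 'I_|lam| row after row: the library's      *)
(* [reshape_index lam i] and [reshape_offset lam i] are the row and the column *)
(* of the i-th cell.                                                           *)
Definition row_stable (lam : seq nat) (p : 'S_(sumn lam)) : bool :=
  [forall i, reshape_index lam (p i) == reshape_index lam i].

Definition col_stable (lam : seq nat) (q : 'S_(sumn lam)) : bool :=
  [forall i, reshape_offset lam (q i) == reshape_offset lam i].

(* The group algebra is the regular representation, with basis vector          *)
(* [delta_mx 0 (gring_index G s)] for s, acted upon by right multiplication.   *)
Definition young_symmetrizer (lam : seq nat) :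
    'rV[algC]_#|[set: 'S_(sumn lam)]| :=
  \sum_(p | row_stable p) \sum_(q | col_stable q)
    (-1) ^+ odd_perm q *:
      delta_mx 0 (gring_index [set: 'S_(sumn lam)] (p * q)%g).

(* The irreducible representation indexed by lam is the right ideal of the     *)
(* group algebra generated by the Young symmetrizer; one row gives the trivial *)
(* representation and one column the sign.                                     *)
Definition specht_repr (lam : seq nat) :=
  submod_repr (cyclic_mx_module (regular_repr algC [set: 'S_(sumn lam)])
                                (young_symmetrizer lam)).

Definition specht_char (lam : seq nat) : 'CF([set: 'S_(sumn lam)]) :=
  cfRepr (specht_repr lam).

Definition has_cycle_type (n : nat) (eta : seq nat) (s : 'S_n) : bool :=
  perm_eq [seq #|C| | C : {set 'I_n} <- enum (porbits s)] eta.

(* The value does not depend on the chosen permutation, [specht_char] being a  *)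
(* class function; 0 is only returned if eta is not, up to order, a partition  *)
(* of |lam|.                                                                   *)
Definition chi (lam eta : seq nat) : algC :=
  if [pick s : 'S_(sumn lam) | has_cycle_type eta s] is Some s
  then specht_char lam s else 0.

(* Main.v *)
Require Import Defs.
From mathcomp Require Import all_boot all_order all_algebra all_fingroup.
From mathcomp Require Import all_field all_character.
From mathcomp Require Import boolp classical_sets fsbigop.
From mathcomp Require Import zify ring.

(* Write [x = lam + delta], with [N] beads. By Frobenius' formula, chi_lam at   *)
(* eta is the coefficient of [X^x] in the Vandermonde determinant times the     *)
(* power sums [p_k], k in eta. This coefficient is an alternating sum of        *)
(* permutation characters, and passing to the holes of the bead configuration   *)
(* rewrites it, up to sign, as the same alternating sum for the conjugate       *)
(* partition twisted by the signature. Pairing the two expressions, all terms   *)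
(* except the leading one die, since a pair of words with the required contents *)
(* that separates all letters must fill the diagram: so this class function     *)
(* has norm 1, and its pairing with the Specht character is 1 by von Neumann's  *)
(* lemma, which forces the two to agree.                                        *)
(*   Multiplying by [p_2 ^ k] then gives [chi_lam (nu, 2^k)] as [k!] times the  *)
(* sum over mu of [chi_mu nu] times the determinant of the                      *)
(* [1 / ((x_i - y_j) / 2)!], with [y = mu + delta] and the entry 0 unless       *)
(* [x_i - y_j] is even and nonnegative. Sorting beads by parity splits it into  *)
(* two determinants of falling factorials, the numerators of the shifted Schur  *)
(* functions of the 2-quotients; the denominators come from mu empty, that is   *)
(* from chi_lam (2, ..., 2), and the sorting permutation has sign sigma_mu up   *)
(* to a constant.                                                               *)

Set Implicit Arguments.
Unset Strict Implicit.
Unset Printing Implicit Defensive.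

Import Order.TTheory GRing.Theory Num.Theory.

Local Open Scope ring_scope.

(** * Frobenius coefficients *)

(** By [chi_frob] both characters are coefficients of the Vandermonde determinant times power sums.
    [frob_domino] splits off the factor p_2^k: it leaves k! times the sum over mu of chi^mu(nu)
    D(mu), where D(mu) is the [domino_det] of lam and mu. For nu empty only mu empty survives
    ([frob_dominoes]), so the ratio is the quotient of the two factorials times the sum of
    chi^mu(nu) D(mu) / D(empty). Here D(mu) vanishes unless mu is balanced and contained in lam
    ([domino_det_neq0_balanced]); otherwise [domino_det_factor], [shifted_schur_part_stable] and
    [balanced_parity_sort] identify D(mu) / D(empty) as sigma_mu s_a(alpha) s_b(beta).

    The formula [chi_frob] rests on [word_factor]: words f, g on the cells that separate all cells
    and have nonzero Vandermonde coefficients are relabellings of the row and column words. This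
    yields both the norm [frob_char_norm] and the pairing [frob_specht_pairing], which
    [specht_char_frob] compares. *)

Section Frobenius.
Variable N : nat.
Implicit Types (x : 'rV[int]_N) (eta : seq nat).

Definition unitv (i : 'I_N) : 'rV[int]_N := delta_mx 0 i.

Definition staircase : 'rV[int]_N := \row_i (N - i.+1)%:Z.

(* The coefficient of [X^x] in the Vandermonde determinant. Exponents are     *)
(* integers, so that the recursion of [frob] needs no side condition.         *)
Definition vander_coef x : algC :=
  \det (\matrix_(i < N, j < N) (x 0 i == staircase 0 j)%:R).

(* [frob eta x] is the coefficient of [X^x] in the product of the Vandermonde *)
(* determinant with the power sums [p_k], k in eta.                           *)
Fixpoint frob eta x : algC :=
  if eta is k :: eta' then \sum_i frob eta' (x - unitv i *+ k)
  else vander_coef x.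

Lemma unitvE i j : unitv i 0 j = (j == i)%:R.
Proof. by rewrite mxE eqxx. Qed.

Lemma frob_cat_cons eta1 k eta2 x :
  frob (eta1 ++ k :: eta2) x = frob (k :: eta1 ++ eta2) x.
Proof.
elim: eta1 x => [|l eta1 IH] x //=.
rewrite exchange_big; apply: eq_bigr => i _ /=.
by rewrite IH /=; apply: eq_bigr => j _; rewrite addrAC.
Qed.

Lemma frob_perm_eq eta1 eta2 x : perm_eq eta1 eta2 -> frob eta1 x = frob eta2 x.
Proof.
elim: eta1 eta2 x => [|k eta1 IH] eta2 x.
  by move/perm_size; case: eta2.
move=> pe; have k2 : k \in eta2 by rewrite -(perm_mem pe) mem_head.
case/splitPr: k2 pe => p1 p2; rewrite perm_sym perm_catC cat_cons perm_cons => pe.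
rewrite frob_cat_cons /=; apply: eq_bigr => i _; apply: IH.
by rewrite perm_sym perm_catC.
Qed.

(** The Vandermonde determinant is alternating and power sums are symmetric, so the coefficients
    alternate in the exponents. *)
Lemma frob_col_perm eta (w : 'S_N) x :
  frob eta (col_perm w x) = (-1) ^+ w * frob eta x.
Proof.
elim: eta x => [|k eta IH] x /=.
  rewrite /vander_coef.
  rewrite -[RHS]/((-1) ^+ w * \det _) -[(-1) ^+ w in RHS]det_perm -det_mulmx -row_permE.
  by congr (\det _); apply/matrixP => i j; rewrite !mxE.
rewrite mulr_sumr [RHS](reindex_inj (@perm_inj _ w)) /=.
have h (i : 'I_N) : col_perm w x - unitv i *+ k = col_perm w (x - unitv (w i) *+ k).
  apply/rowP => j; rewrite !mxE !mulmxnE !mxE !eqxx /=.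
  by rewrite (inj_eq perm_inj).
by apply: eq_bigr => i _; rewrite h IH.
Qed.

Lemma frob_repeated eta x i j : i != j -> x 0 i = x 0 j -> frob eta x = 0.
Proof.
move=> ij xij; have : col_perm (tperm i j) x = x.
  by apply/rowP => l; rewrite mxE; case: tpermP => [->|->|].
move/(congr1 (frob eta)); rewrite frob_col_perm odd_tperm ij expr1 mulN1r.
move/eqP; rewrite eq_sym -subr_eq0 opprK -mulr2n mulrn_eq0 /=.
by move/eqP.
Qed.

Lemma frob_neg eta x i : x 0 i < 0 -> frob eta x = 0.
Proof.
elim: eta x => [|k eta IH] x xi /=.
  rewrite /vander_coef (expand_det_row _ i) big1 // => j _.
  by rewrite !mxE; case: eqP => [e|_]; [lia | rewrite mul0r].
apply: big1 => j _; apply: IH; rewrite !mxE mulmxnE mxE /=.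
by case: (i == j); rewrite /= ?mul0rn; lia.
Qed.

Lemma frob0_staircase : frob [::] staircase = 1.
Proof.
rewrite /= /vander_coef -[RHS](det1 _ N); congr (\det _).
apply/matrixP => i j; rewrite !mxE.
case: (i =P j) => [->|ij]; first by rewrite eqxx.
case: eqP => // e; case: ij; apply/val_inj => /=.
by have := ltn_ord i; have := ltn_ord j; lia.
Qed.

End Frobenius.

(** * Words fixed by a permutation *)

Section FixedWords.
Variable N : nat.
Implicit Types (x : 'rV[int]_N) (eta : seq nat).

Definition content m (f : {ffun 'I_m -> 'I_N}) : 'rV[int]_N := \sum_k unitv (f k).

Definition fixes_word m (f : {ffun 'I_m -> 'I_N}) (s : 'S_m) : bool :=
  [forall i, f (s i) == f i].

Lemma frob_tuple eta x :
  frob eta x = \sum_(t : (size eta).-tuple 'I_N)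
    vander_coef (x - \sum_(p < size eta) unitv (tnth t p) *+ nth 0%N eta p).
Proof.
elim: eta x => [|k eta IH] x /=.
  rewrite (big_pred1 [tuple]) => [|t]; last by rewrite [t]tuple0; apply/esym/eqP.
  by rewrite big_ord0 subr0.
pose h (p : 'I_N * (size eta).-tuple 'I_N) := [tuple of p.1 :: p.2].
rewrite (reindex h) /=; last first.
  exists (fun t => (thead t, [tuple of behead t])) => [[i t]|t] _ /=.
    by congr (_, _); apply/val_inj.
  by rewrite /h /= [RHS]tuple_eta.
rewrite -(pair_bigA _ (fun i t => vander_coef (x -
  \sum_(p < (size eta).+1) unitv (tnth (h (i, t)) p) *+ nth 0%N (k :: eta) p))) /=.
apply: eq_bigr => i _; rewrite IH; apply: eq_bigr => t _.
rewrite big_ord_recl /= tnth0 opprD addrA; congr (vander_coef (_ - _)).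
by apply: eq_bigr => p _; rewrite tnthS.
Qed.

Lemma porbit_ord_subproof m (s : 'S_m) (i : 'I_m) :
  (index (porbit s i) (enum (porbits s)) < size (enum (porbits s)))%N.
Proof. by rewrite index_mem mem_enum imset_f. Qed.

Lemma fixes_word_porbit m (f : {ffun 'I_m -> 'I_N}) (s : 'S_m) i j :
  fixes_word f s -> j \in porbit s i -> f j = f i.
Proof.
move=> /forallP fs /porbitP[k ->]; elim: k => [|k IH]; first by rewrite expg0 perm1.
by rewrite expgSr permM (eqP (fs _)).
Qed.

(** Expanding the power sums attached to the cycles of [s] chooses one letter per cycle. Such a
    choice is a word constant on cycles, and its content is the exponent taken away. So the
    coefficient is an alternating sum of permutation characters on words of given content. *)
Lemma frob_fixed_words m (s : 'S_m) x :
  frob [seq #|C| | C : {set 'I_m} <- enum (porbits s)] x =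
  \sum_(f : {ffun 'I_m -> 'I_N} | fixes_word f s) vander_coef (x - content f).
Proof.
rewrite frob_tuple size_map.
set cs := enum (porbits s).
pose idx (i : 'I_m) := Ordinal (porbit_ord_subproof s i).
pose h (t : (size cs).-tuple 'I_N) := [ffun i => tnth t (idx i)] : {ffun 'I_m -> 'I_N}.
have repP (p : 'I_(size cs)) : exists i, idx i == p.
  have : nth finset.set0 cs p \in cs by apply: mem_nth.
  rewrite mem_enum => /imsetP[i _ e]; exists i; apply/eqP/val_inj => /=.
  by rewrite -e index_uniq // enum_uniq.
pose rep p := xchoose (repP p).
have idxK p : idx (rep p) = p by apply/eqP/(xchooseP (repP p)).
have idxE i : nth finset.set0 cs (idx i) = porbit s i.
  by rewrite nth_index // mem_enum imset_f.
have idx_eq i j : idx i = idx j -> j \in porbit s i.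
  by move=> e; rewrite porbit_sym -eq_porbit_mem -!idxE e.
pose h' (f : {ffun 'I_m -> 'I_N}) := [tuple f (rep p) | p < size cs].
rewrite [RHS](reindex_onto h h') /=; last first.
  move=> f fs; apply/ffunP => i; rewrite ffunE tnth_mktuple.
  by apply: (fixes_word_porbit fs); apply: idx_eq; rewrite idxK.
apply: eq_big => [t|t _].
  apply/esym/andP; split.
    apply/forallP => i; rewrite !ffunE; apply/eqP; congr (tnth t _); apply/val_inj => /=.
    by congr (index _ _); rewrite -[s i](congr1 (fun t : 'S_m => t i) (expg1 s)) porbit_perm.
  by apply/eqP/eq_from_tnth => p; rewrite tnth_mktuple ffunE idxK.
congr (vander_coef (_ - _)).
rewrite /content (partition_big idx xpredT) //=.
apply: eq_bigr => p _.
rewrite (eq_bigr (fun=> unitv (tnth t p))) => [|i /eqP <-]; last by rewrite ffunE.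
rewrite sumr_const (nth_map finset.set0) //; congr (_ *+ _).
have -> : nth finset.set0 cs p = porbit s (rep p) by rewrite -idxE idxK.
apply: eq_card => i.
have -> : (i \in [pred j | idx j == p]) = (idx i == p) by [].
rewrite -eq_porbit_mem -{2}[p]idxK; apply/eqP/eqP => e.
  by apply/val_inj => /=; rewrite e.
by apply/esym/eqP; rewrite eq_porbit_mem; apply: idx_eq.
Qed.

End FixedWords.

Lemma frob_recl N k eta (x : 'rV[int]_N) :
  frob (k :: eta) x = \sum_i frob eta (x - unitv i *+ k).
Proof. by []. Qed.

(** * Beads and holes *)

Section Complement.
Variables N M : nat.
Implicit Types (z : 'S_(N + M)) (eta : seq nat).

(** The permutation [z] puts beads on the images of the first [N] indices and holes on the others.
    Holes are measured from the opposite end, so that a bead moving down by k into a hole lowers the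
    coordinate of that hole by k as well. *)
Definition beads z : 'rV[int]_N := \row_i (z (lshift M i))%:Z.
Definition holes z : 'rV[int]_M := \row_j (N + M - (z (rshift N j)).+1)%:Z.

Lemma beads_jump z i j k : z (lshift M i) = (z (rshift N j) + k)%N :> nat ->
  beads (tperm (lshift M i) (rshift N j) * z) = beads z - unitv i *+ k.
Proof.
move=> e; apply/rowP => l; rewrite !mxE mulmxnE mxE eqxx /= permM.
have [->|li] := eqVneq l i; first by rewrite tpermL e /=; lia.
rewrite tpermD ?eq_lrshift ?eq_rlshift ?(inj_eq (@lshift_inj _ _)) //; last by rewrite eq_sym.
by rewrite mul0rn subr0.
Qed.

Lemma holes_jump z i j k : z (lshift M i) = (z (rshift N j) + k)%N :> nat ->
  holes (tperm (lshift M i) (rshift N j) * z) = holes z - unitv j *+ k.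
Proof.
move=> e; apply/rowP => l; rewrite !mxE mulmxnE mxE eqxx /= permM.
have [->|li] := eqVneq l j.
  by rewrite tpermR e /=; have := ltn_ord (z (lshift M i)); rewrite e; lia.
rewrite tpermD ?eq_lrshift ?eq_rlshift ?(inj_eq (@rshift_inj _ _)) //; last by rewrite eq_sym.
by rewrite mul0rn subr0.
Qed.

Definition jump z k (p : 'I_N * 'I_M) : bool :=
  (z (lshift M p.1) == z (rshift N p.2) + k :> nat)%N.

Definition jumped z (p : 'I_N * 'I_M) : 'S_(N + M) :=
  (tperm (lshift M p.1) (rshift N p.2) * z)%g.

(** Lowering a bead by k takes it below 0, onto another bead, or into a hole; the first two cases
    give 0 by [frob_neg] and [frob_repeated]. *)
Lemma frob_beads k eta z : (0 < k)%N ->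
  frob (k :: eta) (beads z) = \sum_(p | jump z k p) frob eta (beads (jumped z p)).
Proof.
move=> k0; rewrite frob_recl.
rewrite (eq_bigl (fun p => xpredT p.1 && jump z k (p.1, p.2))); last by case.
rewrite -(pair_big_dep xpredT (fun i j => jump z k (i, j))
  (fun i j => frob eta (beads (jumped z (i, j))))) /=.
apply: eq_bigr => i _.
have [ltk|lek] := ltnP (z (lshift M i)) k.
  rewrite (@frob_neg _ _ _ i); last by rewrite !mxE mulmxnE mxE !eqxx /=; lia.
  by rewrite big1 // => j /eqP /=; lia.
have ltu : (z (lshift M i) - k < N + M)%N by have := ltn_ord (z (lshift M i)); lia.
pose u := Ordinal ltu.
have zu : z ((z^-1)%g u) = u by rewrite permKV.
have [i' e|j e] := split_ordP ((z^-1)%g u).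
  have ii' : i != i'.
    apply/eqP => ii; move: zu; rewrite e -ii => /(congr1 val) /=; lia.
  rewrite (@frob_repeated _ _ _ i i') //; last first.
    rewrite !mxE !mulmxnE !mxE !eqxx eq_sym (negbTE ii') /= -e zu /=; lia.
  rewrite big1 // => j /eqP /= ej.
  have : z (rshift N j) = z (lshift M i') by apply/val_inj; rewrite -e zu /=; lia.
  by move/perm_inj/eqP; rewrite eq_rlshift.
have ej : z (lshift M i) = (z (rshift N j) + k)%N :> nat by rewrite -e zu /=; lia.
rewrite (big_pred1 j) => [|j' /=]; first by rewrite -(beads_jump ej).
rewrite /jump /= ej eqn_add2r; apply/eqP/eqP => [e'|->//].
by apply/esym; have /perm_inj/rshift_inj : z (rshift N j) = z (rshift N j') by apply/val_inj.
Qed.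

Lemma frob_holes k eta z : (0 < k)%N ->
  frob (k :: eta) (holes z) = \sum_(p | jump z k p) frob eta (holes (jumped z p)).
Proof.
move=> k0; rewrite frob_recl.
rewrite (eq_bigl (fun p => xpredT p.1 && jump z k (p.1, p.2))); last by case.
rewrite -(pair_big_dep xpredT (fun i j => jump z k (i, j))
  (fun i j => frob eta (holes (jumped z (i, j))))) /=.
rewrite (exchange_big_dep xpredT) //=.
apply: eq_bigr => j _.
have zj := ltn_ord (z (rshift N j)).
have [ltk|lek] := leqP (N + M) (z (rshift N j) + k)%N.
  rewrite (@frob_neg _ _ _ j); last by rewrite !mxE mulmxnE mxE !eqxx /=; lia.
  by rewrite big1 // => i /eqP /=; have := ltn_ord (z (lshift M i)); lia.
pose u := Ordinal lek.
have zu : z ((z^-1)%g u) = u by rewrite permKV.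
have [i e|j' e] := split_ordP ((z^-1)%g u); last first.
  have ii' : j != j'.
    apply/eqP => ii; move: zu; rewrite e -ii => /(congr1 val) /=; lia.
  rewrite (@frob_repeated _ _ _ j j') //; last first.
    rewrite !mxE !mulmxnE !mxE !eqxx eq_sym (negbTE ii') /= -e zu /=; lia.
  rewrite big1 // => i /eqP /= ej.
  have : z (lshift M i) = z (rshift N j') by apply/val_inj; rewrite -e zu /=; lia.
  by move/perm_inj/eqP; rewrite eq_lrshift.
have ei : z (lshift M i) = (z (rshift N j) + k)%N :> nat by rewrite -e zu /=; lia.
rewrite (big_pred1 i) => [|i' /=]; first by rewrite -(holes_jump ei).
rewrite /jump /= -ei; apply/eqP/eqP => [e'|->//].
by have /perm_inj/lshift_inj : z (lshift M i') = z (lshift M i) by apply/val_inj.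
Qed.

End Complement.

Section ComplementSign.
Variables N M : nat.
Implicit Types (z : 'S_(N + M)).

Definition rev_perm : 'S_N := perm (@rev_ord_inj N).

(** Jacobi's identity for complementary minors, for a permutation matrix. If the upper right block
    has a nonzero entry, both minors have a zero row or column; otherwise the matrix is block
    triangular and the upper left minor squares to 1. *)
Lemma det_complement_perm (R : comNzRingType) z :
  \det (drsubmx (perm_mx z : 'M[R]_(N + M))) = (-1) ^+ z * \det (ulsubmx (perm_mx z)).
Proof.
set P := perm_mx z : 'M[R]_(N + M).
have [/existsP[i /existsP[j /eqP zi]]|] :=
    boolP [exists i, exists j, z (lshift M i) == rshift N j].
  rewrite (expand_det_col _ j) big1 => [|j' _]; last first.
    rewrite !mxE; case: eqP => [e|_]; last by rewrite mul0r.
    have /perm_inj/eqP : z (rshift N j') = z (lshift M i) by rewrite zi.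
    by rewrite eq_rlshift.
  rewrite (expand_det_row _ i) big1 ?mulr0 // => i' _.
  by rewrite !mxE zi eq_rlshift mul0r.
rewrite negb_exists => /forallP nz.
have ur0 : ursubmx P = 0.
  apply/matrixP => i j; rewrite !mxE; move: (nz i); rewrite negb_exists.
  by move/forallP/(_ j)/negbTE => ->.
have detP : \det P = \det (ulsubmx P) * \det (drsubmx P).
  by rewrite -[P in LHS]submxK ur0 det_lblock.
have ul2 : \det (ulsubmx P) * \det (ulsubmx P) = 1.
  rewrite -{2}det_tr -det_mulmx.
  have : P *m P^T = 1%:M by rewrite tr_perm_mx -perm_mxM mulgV perm_mx1.
  rewrite -[P in P *m _]submxK -[P in P^T]submxK ur0 tr_block_mx mulmx_block.
  rewrite trmx0 mulmx0 addr0 scalar_mx_block => /eq_block_mx[-> _ _ _].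
  by rewrite det1.
by rewrite -(det_perm R z) -/P detP mulrAC ul2 mul1r.
Qed.

(** The holes give the lower right minor of [perm_mx z], the beads its upper left minor with columns
    reversed. *)
Lemma vander_coef_complement z :
  vander_coef (beads z) = (-1) ^+ rev_perm * (-1) ^+ z * vander_coef (holes z).
Proof.
have -> : vander_coef (holes z) = \det (drsubmx (perm_mx z)).
  congr (\det _); apply/matrixP => i j; rewrite !mxE; congr (nat_of_bool _)%:R.
  have := ltn_ord (z (rshift N i)); have := ltn_ord j.
  by rewrite -val_eqE /=; lia.
rewrite det_complement_perm mulrA -[_ * _ * _ ^+ z]mulrA -expr2 sqrr_sign mulr1.
rewrite -odd_permV -det_perm mulrC -det_mulmx -col_permE.
congr (\det _); apply/matrixP => i j; rewrite !mxE; congr (nat_of_bool _)%:R.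
by rewrite permE -val_eqE /=; lia.
Qed.

(** Beads and holes obey the same recursion, except that each jump multiplies [z] by a transposition
    and so costs one sign per part of [eta]. *)
Lemma frob_complement eta z : all (leq 1) eta ->
  frob eta (beads z) =
  (-1) ^+ rev_perm * (-1) ^+ size eta * (-1) ^+ z * frob eta (holes z).
Proof.
elim: eta z => [|k eta IH] z; first by rewrite mulr1 => _; apply: vander_coef_complement.
case/andP => k0 eta0; rewrite frob_beads // frob_holes // mulr_sumr.
apply: eq_bigr => p _; rewrite IH // odd_permM odd_tperm eq_lrshift /=.
by rewrite signrN exprS mulN1r !mulrN !mulNr.
Qed.

End ComplementSign.

(** * Contents of words and hook lengths *)

Definition conj_part (lam : seq nat) (j : nat) : nat := count (ltn j) lam.

Lemma ltn_conj_part lam i j : is_part lam ->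
  (j < nth 0 lam i)%N = (i < conj_part lam j)%N.
Proof.
case/andP => + _; rewrite /conj_part.
elim: lam i => [|a lam IH] [|i] //= alam.
  case: ltnP => //= aj; rewrite add0n.
  have /allP/= le_a := order_path_min (rev_trans leq_trans) alam.
  by apply/esym/negbTE; rewrite -has_count; apply/hasPn => b /le_a /=; lia.
rewrite IH ?(path_sorted alam) //.
have [//|aj] := ltnP j a.
suff -> : count (ltn j) lam = 0%N by [].
have /allP/= le_a := order_path_min (rev_trans leq_trans) alam.
by apply/eqP; rewrite -leqn0 leqNgt -has_count; apply/hasPn => b /le_a /=; lia.
Qed.

Lemma nth_part_mono lam i j : is_part lam -> (i <= j)%N ->
  (nth 0 lam j <= nth 0 lam i)%N.
Proof.
move=> plam ij; rewrite leqNgt ltn_conj_part // -leqNgt.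
by rewrite (leq_trans _ ij) // leqNgt -ltn_conj_part // ltnn.
Qed.

Lemma conj_part_le_size lam j : (conj_part lam j <= size lam)%N.
Proof. exact: count_size. Qed.

Definition beta_row N (f : nat -> nat) : 'rV[int]_N :=
  \row_i (f i + (N - i.+1))%:Z.

(** Distinct naturals in the first [l] places add up to at least 0 + ... + (l - 1). In the proof [m]
    is the negative part of v - l, whose total over all places [w] does not change. *)
Lemma sum_perm_prefix N (w : 'S_N) l :
  0 <= \sum_(i < N | (i < l)%N) ((w i)%:Z - (i : nat)%:Z).
Proof.
pose m (v : nat) : int := if (v < l)%N then v%:Z - l%:Z else 0.
have m0 v : m v <= 0 by rewrite /m; case: ltnP; lia.
have -> : \sum_(i < N | (i < l)%N) ((w i)%:Z - (i : nat)%:Z) =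
  \sum_(i < N | (i < l)%N) ((w i)%:Z - l%:Z) - \sum_(i < N | (i < l)%N) ((i : nat)%:Z - l%:Z).
  by rewrite -sumrB; apply: eq_bigr => i _; ring.
rewrite subr_ge0 big_mkcond -[X in X <= _]/(\sum_(i < N) m i).
rewrite (reindex_inj (@perm_inj _ w)) /=.
rewrite [X in X <= _](bigID (fun i : 'I_N => (i < l)%N)) /=.
rewrite -[X in _ <= X]addr0 lerD ?sumr_le0 //.
by apply: ler_sum => i _; rewrite /m; case: ltnP; lia.
Qed.

Section Rearrangement.
Variables (lam : seq nat) (N : nat) (w : 'S_N).
Hypothesis lam_part : is_part lam.

Let x := beta_row N (nth 0%N lam).

(** The parts are sums over the columns of the diagram, and each column is a prefix of the rows. *)
Lemma sum_displacement_ge0 :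
  0 <= \sum_(i < N) ((w i)%:Z - (i : nat)%:Z) * (nth 0%N lam i)%:Z.
Proof.
pose M := nth 0%N lam 0.
have -> : \sum_(i < N) ((w i)%:Z - (i : nat)%:Z) * (nth 0%N lam i)%:Z =
  \sum_(j < M) \sum_(i < N | (i < conj_part lam j)%N) ((w i)%:Z - (i : nat)%:Z).
  rewrite (exchange_big_dep xpredT) //=; apply: eq_bigr => i _.
  have lM : (nth 0%N lam i <= M)%N by apply: nth_part_mono.
  have -> : (nth 0%N lam i)%:Z = \sum_(j < M | (j < nth 0%N lam i)%N) 1.
    rewrite -(big_ord_widen _ (fun=> 1) lM) sumr_const card_ord.
    by rewrite natz.
  rewrite mulr_sumr.
  by apply: eq_big => [j|j _]; rewrite ?mulr1 // -ltn_conj_part.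
by apply: sumr_ge0 => j _; apply: sum_perm_prefix.
Qed.

(** The sums of i and of i^2 are invariant under [w]; only the cross term of the square remains. *)
Lemma sum_displacement_sqr :
  \sum_(i < N) ((w i)%:Z - (i : nat)%:Z) * (N - i.+1)%:Z *+ 2 =
  \sum_(i < N) ((w i)%:Z - (i : nat)%:Z) ^+ 2.
Proof.
apply/eqP; rewrite -subr_eq0 -sumrB.
have -> : \sum_(i < N) (((w i)%:Z - (i : nat)%:Z) * (N - i.+1)%:Z *+ 2
    - ((w i)%:Z - (i : nat)%:Z) ^+ 2) =
  \sum_(i < N) (((i : nat)%:Z ^+ 2 - (N%:Z - 1) * (i : nat)%:Z *+ 2)
   - ((w i : nat)%:Z ^+ 2 - (N%:Z - 1) * (w i : nat)%:Z *+ 2)).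
  apply: eq_bigr => i _.
  have -> : (N - i.+1)%:Z = N%:Z - 1 - (i : nat)%:Z by have := ltn_ord i; lia.
  by ring.
by rewrite sumrB [X in _ - X](reindex_inj (@perm_inj _ w^-1)) /=
   (eq_bigr _ (fun i _ => congr1 (fun k : 'I_N => (k : nat)%:Z ^+ 2 - (N%:Z - 1) * (k : nat)%:Z *+ 2) (permKV w i))) subrr.
Qed.

Lemma rearrangement_ge0 : 0 <= \sum_i (staircase N 0 i - staircase N 0 (w i)) * x 0 i.
Proof.
have -> : \sum_i (staircase N 0 i - staircase N 0 (w i)) * x 0 i =
  \sum_(i < N) ((w i)%:Z - (i : nat)%:Z) * (nth 0%N lam i)%:Z +
  \sum_(i < N) ((w i)%:Z - (i : nat)%:Z) * (N - i.+1)%:Z.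
  rewrite -big_split /=; apply: eq_bigr => i _; rewrite !mxE PoszD -mulrDr.
  by congr (_ * _); have := ltn_ord i; have := ltn_ord (w i); lia.
apply: addr_ge0; first exact: sum_displacement_ge0.
rewrite -(pmulrn_lge0 _ (isT : (0 < 2)%N)) -sumrMnl sum_displacement_sqr.
by apply: sumr_ge0 => i _; apply: sqr_ge0.
Qed.

(** The staircase contributes half the sum of the squared displacements and the parts contribute a
    nonnegative amount, so every displacement must vanish. *)
Lemma rearrangement_eq1 :
  \sum_i (staircase N 0 i - staircase N 0 (w i)) * x 0 i <= 0 -> w = 1%g.
Proof.
have -> : \sum_i (staircase N 0 i - staircase N 0 (w i)) * x 0 i =
  \sum_(i < N) ((w i)%:Z - (i : nat)%:Z) * (nth 0%N lam i)%:Z +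
  \sum_(i < N) ((w i)%:Z - (i : nat)%:Z) * (N - i.+1)%:Z.
  rewrite -big_split /=; apply: eq_bigr => i _; rewrite !mxE PoszD -mulrDr.
  by congr (_ * _); have := ltn_ord i; have := ltn_ord (w i); lia.
move=> le0; have := sum_displacement_ge0; have := sum_displacement_sqr.
rewrite sumrMnl => e ge0.
have : \sum_(i < N) ((w i)%:Z - (i : nat)%:Z) ^+ 2 = 0.
  apply/eqP; rewrite eq_le [X in _ && X]sumr_ge0 ?andbT => [|i _]; last exact: sqr_ge0.
  by rewrite -e pmulrn_lle0 // (le_trans _ le0) // lerDr.
move/eqP; rewrite psumr_eq0 => [/allP h|i _]; last exact: sqr_ge0.
apply/permP => i; rewrite perm1; apply/val_inj => /=.
have := h i (mem_index_enum _); rewrite sqrf_eq0 subr_eq0 => /eqP; lia.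
Qed.

End Rearrangement.

(** * Cells of the diagram, hooks and the boundary path *)

Section Cells.
Variables (lam : seq nat) (N M : nat).
Hypotheses (lam_part : is_part lam) (leN : (size lam <= N)%N).
Hypothesis leM : (nth 0%N lam 0 <= M)%N.
Local Notation m := (sumn lam).

Lemma row_subproof (k : 'I_m) : (reshape_index lam k < N)%N.
Proof. exact: leq_trans (reshape_indexP (ltn_ord k)) leN. Qed.

Lemma col_subproof (k : 'I_m) : (reshape_offset lam k < M)%N.
Proof.
apply: leq_trans (reshape_offsetP (ltn_ord k)) (leq_trans _ leM).
exact: nth_part_mono.
Qed.

Definition row_word : {ffun 'I_m -> 'I_N} := [ffun k => Ordinal (row_subproof k)].
Definition col_word : {ffun 'I_m -> 'I_M} := [ffun k => Ordinal (col_subproof k)].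

Lemma cell_word_inj : injective (fun k => (row_word k, col_word k)).
Proof.
move=> k l []; rewrite !ffunE => /(congr1 val)/= er /(congr1 val)/= ec.
apply/val_inj; rewrite /= -(reshape_indexK lam k) -(reshape_indexK lam l).
by rewrite er ec.
Qed.

Lemma cell_wordP k : (col_word k < nth 0%N lam (row_word k))%N.
Proof. by rewrite !ffunE; apply: reshape_offsetP. Qed.

Lemma cell_word_onto (i : 'I_N) (j : 'I_M) : (j < nth 0%N lam i)%N ->
  exists k, row_word k = i /\ col_word k = j.
Proof.
move=> ji; exists (Ordinal (flatten_indexP ji)).
by rewrite !ffunE; split; apply/val_inj; rewrite /= ?flatten_indexKl ?flatten_indexKr.
Qed.

Lemma sum_cells (V : nmodType) (F : 'I_N -> 'I_M -> V) :
  \sum_k F (row_word k) (col_word k) =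
  \sum_(i < N) \sum_(j < M | (j < nth 0%N lam i)%N) F i j.
Proof.
rewrite pair_big_dep /=.
rewrite -(big_imset (fun c : 'I_N * 'I_M => F c.1 c.2) (in2W cell_word_inj)) /=.
apply: eq_bigl => -[i j] /=; apply/imsetP/idP => [[k _ [-> ->]]|/cell_word_onto[k [<- <-]]].
  exact: cell_wordP.
by exists k.
Qed.

Lemma content_row_word : content row_word = \row_i (nth 0%N lam i)%:Z.
Proof.
rewrite /content (sum_cells (fun i _ => unitv i)); apply/rowP => i.
rewrite summxE (bigD1 i) //= [X in _ + X]big1 ?addr0 => [|i' ii']; last first.
  by rewrite summxE big1 // => j _; rewrite unitvE eq_sym (negbTE ii').
have lM : (nth 0%N lam i <= M)%N by apply: leq_trans leM; apply: nth_part_mono.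
rewrite summxE; under eq_bigr do rewrite unitvE eqxx.
by rewrite -(big_ord_widen _ (fun=> 1) lM) sumr_const card_ord mxE natz.
Qed.

Lemma content_col_word : content col_word = \row_j (conj_part lam j)%:Z.
Proof.
rewrite /content (sum_cells (fun _ j => unitv j)); apply/rowP => j.
rewrite (exchange_big_dep xpredT) //= summxE (bigD1 j) //= [X in _ + X]big1 ?addr0 => [|j' jj']; last first.
  by rewrite summxE big1 // => i _; rewrite unitvE eq_sym (negbTE jj').
have lN : (conj_part lam j <= N)%N by apply: leq_trans leN; apply: conj_part_le_size.
rewrite summxE mxE -[RHS]natz.
rewrite -[X in _ = X%:R]card_ord -[RHS]sumr_const (big_ord_widen _ (fun=> 1) lN).
by apply: eq_big => [i|i _]; rewrite ?unitvE ?eqxx // ltn_conj_part.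
Qed.

(* The hook length on the diagram, and negative outside. Being a sum of a row *)
(* and a column term, its total over a pair of words depends on the contents   *)
(* only, and among separating pairs it is maximal for the diagram itself.      *)
Definition hook (i : 'I_N) (j : 'I_M) : int :=
  beta_row N (nth 0%N lam) 0 i + beta_row M (conj_part lam) 0 j - (N + M)%:Z + 1.

Lemma hook_gt0 (i : 'I_N) (j : 'I_M) : (j < nth 0%N lam i)%N -> 0 < hook i j.
Proof.
move=> ji; have := ji; rewrite ltn_conj_part // => ij.
by rewrite /hook !mxE; have := ltn_ord i; have := ltn_ord j; lia.
Qed.

Lemma hook_lt0 (i : 'I_N) (j : 'I_M) : (nth 0%N lam i <= j)%N -> hook i j < 0.
Proof.
move=> ji; have := ji; rewrite leqNgt ltn_conj_part // -leqNgt => ij.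
by rewrite /hook !mxE; have := ltn_ord i; have := ltn_ord j; lia.
Qed.

(** The steps of the boundary path of the diagram: rows give vertical steps (beads) and columns give
    horizontal ones (holes), which together occupy each of the [N + M] positions once. *)
Definition bead_pos (p : 'I_(N + M)) : nat :=
  match split p with
  | inl i => nth 0%N lam i + (N - i.+1)
  | inr j => N + j - conj_part lam j
  end.

Lemma bead_pos_subproof p : (bead_pos p < N + M)%N.
Proof.
rewrite /bead_pos; case: split => [i|j].
  have := @nth_part_mono lam 0 i lam_part (leq0n _); have := ltn_ord i; lia.
have := ltn_ord j; lia.
Qed.

Lemma bead_pos_inj : injective (fun p => Ordinal (bead_pos_subproof p)).
Proof.
have mono (i i' : 'I_N) : (nth 0 lam i + (N - i.+1) = nth 0 lam i' + (N - i'.+1))%N -> i = i'.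
  move=> e; apply/val_inj => /=; have := ltn_ord i; have := ltn_ord i'.
  have [ii|/ltnW ii] := leqP i i'; have := nth_part_mono lam_part ii; lia.
have ltc j : (conj_part lam j <= N)%N by apply: leq_trans leN; apply: conj_part_le_size.
have cmono (j j' : nat) : (j <= j')%N -> (conj_part lam j' <= conj_part lam j)%N.
  by move=> jj; apply: sub_count => a /=; lia.
have cmono' (j j' : 'I_M) :
    (N + j - conj_part lam j = N + j' - conj_part lam j')%N -> j = j'.
  move=> e; apply/val_inj => /=; have := ltc j; have := ltc j'.
  by have [jj|jj] := leqP j j'; [have := cmono _ _ jj|have := cmono _ _ (ltnW jj)]; lia.
(* The difference of these positions is the [hook] of row [i] and column [j], which is never 0. *)
have sep (i : 'I_N) (j : 'I_M) : (nth 0 lam i + (N - i.+1) <> N + j - conj_part lam j)%N.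
  move=> e; have := ltn_ord i; have := ltc j; have := ltn_conj_part i j lam_part.
  by case: ltnP; case: ltnP => //; lia.
move=> p q /(congr1 val) /=; rewrite /bead_pos.
case: split_ordP => i ->; case: split_ordP => j ->.
- by move/mono ->.
- by move/sep.
- by move/esym/sep.
- by move/cmono' ->.
Qed.

Definition bead_perm : 'S_(N + M) := perm bead_pos_inj.

Lemma beads_bead_perm : beads bead_perm = beta_row N (nth 0%N lam).
Proof.
by apply/rowP => i; rewrite !mxE permE /= /bead_pos; case: split_ordP => // j /eqP;
   rewrite ?eq_lrshift // => /eqP/lshift_inj ->.
Qed.

Lemma holes_bead_perm : holes bead_perm = beta_row M (conj_part lam).
Proof.
apply/rowP => i; rewrite !mxE permE /= /bead_pos; case: split_ordP => j /eqP;
   rewrite ?eq_rlshift // => /eqP/rshift_inj ->.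
have : (conj_part lam j <= N)%N by apply: leq_trans leN; apply: conj_part_le_size.
by have := ltn_ord j; lia.
Qed.

(** On a cycle type the sign (-1)^(size eta) is the signature up to a constant: this is conjugation
    of the partition as a twist by the sign character. *)
Lemma frob_conj_part : exists c : bool, forall eta, all (leq 1) eta ->
  frob eta (beta_row N (nth 0%N lam)) =
  (-1) ^+ c * (-1) ^+ size eta * frob eta (beta_row M (conj_part lam)).
Proof.
exists (rev_perm N (+) bead_perm) => eta eta0.
rewrite -beads_bead_perm -holes_bead_perm frob_complement // signr_addb.
by rewrite -!mulrA; congr (_ * _); rewrite mulrCA.
Qed.

End Cells.

Lemma vander_coef_neq0 N (x : 'rV[int]_N) :
  vander_coef x != 0 -> exists w : 'S_N, x = col_perm w (staircase N).
Proof.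
have [/existsP[w /eqP ->]|nw] := boolP [exists w : 'S_N, x == col_perm w (staircase N)].
  by exists w.
case/eqP; rewrite /vander_coef /determinant big1 // => w _.
move: nw; rewrite negb_exists => /forallP/(_ w); case: (pickP (fun i => x 0 i != staircase N 0 (w i))).
  by move=> i /negbTE xi _; rewrite (bigD1 i) //= mxE xi mul0r mulr0.
by move=> e /eqP[]; apply/rowP => i; rewrite mxE; apply/eqP/negbNE; rewrite e.
Qed.

Lemma sum_content m N (f : {ffun 'I_m -> 'I_N}) (X : 'I_N -> int) :
  \sum_k X (f k) = \sum_i content f 0 i * X i.
Proof.
transitivity (\sum_i \sum_k unitv (f k) 0 i * X i).
  rewrite exchange_big; apply: eq_bigr => k _ /=.
  rewrite (bigD1 (f k)) //= unitvE eqxx mul1r big1 ?addr0 // => i ik.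
  by rewrite unitvE (negbTE ik) mul0r.
by apply: eq_bigr => i _; rewrite -mulr_suml /content summxE.
Qed.

Lemma content_perm m N (f : {ffun 'I_m -> 'I_N}) (u : 'S_m) :
  content [ffun k => f (u k)] = content f.
Proof.
rewrite /content [RHS](reindex_inj (@perm_inj _ u)) /=.
by apply: eq_bigr => k _; rewrite ffunE.
Qed.

Lemma conj_part_is_part lam : is_part lam ->
  exists2 mu, is_part mu & nth 0%N mu = conj_part lam.
Proof.
move=> lam_part; exists (mkseq (conj_part lam) (nth 0%N lam 0)).
  apply/andP; split; last first.
    by apply/mapP => -[j]; rewrite mem_iota add0n /= ltn_conj_part // => lt0 e; lia.
  rewrite sorted_map; apply: sub_sorted (iota_sorted 0 _) => i j /= ij.
  by apply: sub_count => a /=; lia.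
apply/funext => j; have [lt|le] := ltnP j (nth 0%N lam 0); first by rewrite nth_mkseq.
rewrite nth_default ?size_mkseq //; apply/esym/eqP.
by rewrite -leqn0 leqNgt -ltn_conj_part // -leqNgt.
Qed.

(** * Rigidity of separating pairs of words *)

Section Rigidity.
Variables (lam : seq nat) (N M : nat).
Hypotheses (lam_part : is_part lam) (leN : (size lam <= N)%N).
Hypothesis leM : (nth 0%N lam 0 <= M)%N.
Local Notation m := (sumn lam).
Local Notation x := (beta_row N (nth 0%N lam)).
Local Notation y := (beta_row M (conj_part lam)).
Local Notation rowf := (row_word leN).
Local Notation colf := (col_word lam_part leM).
Local Notation hook := (@hook lam N M).
Implicit Types (f : {ffun 'I_m -> 'I_N}) (g : {ffun 'I_m -> 'I_M}).

Lemma sum_hook f g : \sum_k hook (f k) (g k) =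
  \sum_i content f 0 i * x 0 i + \sum_j content g 0 j * y 0 j + (1 - (N + M)%:Z) *+ m.
Proof.
have -> : (1 - (N + M)%:Z) *+ m = \sum_(k < m) (1 - (N + M)%:Z).
  by rewrite sumr_const card_ord.
rewrite -!sum_content -!big_split /=.
by apply: eq_bigr => k _; rewrite /hook; ring.
Qed.

(** The pairs of letters are distinct places, and [hook] is positive on the diagram and negative off
    it; so the diagram itself has the largest total, and a place outside would lose strictly. *)
Lemma hook_sum_le f g : injective (fun k => (f k, g k)) ->
  \sum_k hook (f k) (g k) <= \sum_k hook (rowf k) (colf k) /\
  (\sum_k hook (f k) (g k) = \sum_k hook (rowf k) (colf k) ->
   forall k, (g k < nth 0%N lam (f k))%N).
Proof.
move=> fg_inj; rewrite (sum_cells lam_part leN leM).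
rewrite pair_big_dep -(big_imset (fun c => hook c.1 c.2) (in2W fg_inj)) /=.
rewrite [X in X <= _]big_mkcond [X in _ <= X]big_mkcond.
rewrite [X in X = _]big_mkcond [X in _ = X]big_mkcond /=.
set im := [set _ | _ in _]%SET.
set F := BIG_F; set G := (X in _ <= \sum_c X c).
have FG c : F c <= G c.
  rewrite /F /G; case: c => i j /=.
  case: ifP => _; case: ltnP => ij //.
    exact: ltW (hook_lt0 lam_part leN leM _).
  exact: ltW (hook_gt0 lam_part leN leM _).
split=> [|/esym/eqP]; first exact: ler_sum.
rewrite -subr_eq0 -sumrB psumr_eq0 => [/allP e k|c _]; last by rewrite subr_ge0.
have := e (f k, g k) (mem_index_enum _); rewrite subr_eq0 /F /G /= imset_f //.
case: ltnP => // /(hook_lt0 lam_part leN leM) h0 /eqP eh.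
by rewrite -eh ltxx in h0.
Qed.

(** The hook total depends on the contents only. Its excess over that of the diagram is a sum of two
    rearrangement terms, both nonnegative, whereas [hook_sum_le] makes it nonpositive; hence both
    are 0 and [rearrangement_eq1] applies. *)
Lemma word_rigid f g (w : 'S_N) (w' : 'S_M) : injective (fun k => (f k, g k)) ->
  x - content f = col_perm w (staircase N) ->
  y - content g = col_perm w' (staircase M) ->
  [/\ w = 1%g, w' = 1%g & forall k, (g k < nth 0%N lam (f k))%N].
Proof.
move=> fg_inj ef eg; have [le1 eq1] := hook_sum_le fg_inj.
have dx (N' : nat) (z c : 'rV[int]_N') (v : 'S_N') h : z - c = col_perm v (staircase N') ->
    z = h + staircase N' ->
    \sum_i c 0 i * z 0 i - \sum_i h 0 i * z 0 i =
    \sum_i (staircase N' 0 i - staircase N' 0 (v i)) * z 0 i.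
  move=> e1 e2; rewrite -sumrB; apply: eq_bigr => i _; rewrite -mulrBl; congr (_ * _).
  have -> : c = z - col_perm v (staircase N') by rewrite -e1 opprB addrC subrK.
  by rewrite {1}e2 !mxE; ring.
have ex : x = \row_i (nth 0%N lam i)%:Z + staircase N by apply/rowP => i; rewrite !mxE PoszD.
have ey : y = \row_i (conj_part lam i)%:Z + staircase M by apply/rowP => i; rewrite !mxE PoszD.
have Dx := dx _ _ _ _ _ ef ex.
have Dy := dx _ _ _ _ _ eg ey.
have [mu mu_part emu] := conj_part_is_part lam_part.
have Rx := rearrangement_ge0 w lam_part.
have := rearrangement_ge0 w' mu_part; rewrite emu => Ry.
have S := congr2 (fun a b => a - b) (sum_hook f g) (sum_hook rowf colf).
rewrite (content_row_word lam_part leN leM) (content_col_word lam_part leN leM) in S.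
have {S} eS : \sum_k hook (f k) (g k) - \sum_k hook (rowf k) (colf k) =
  \sum_i (staircase N 0 i - staircase N 0 (w i)) * x 0 i +
  \sum_i (staircase M 0 i - staircase M 0 (w' i)) * y 0 i.
  by rewrite -Dx -Dy S; ring.
have le0 : \sum_i (staircase N 0 i - staircase N 0 (w i)) * x 0 i +
  \sum_i (staircase M 0 i - staircase M 0 (w' i)) * y 0 i <= 0.
  by rewrite -eS subr_le0.
split.
- by apply: (rearrangement_eq1 lam_part); apply: le_trans le0; rewrite lerDl.
- apply: (rearrangement_eq1 mu_part); apply: le_trans le0.
  by rewrite emu lerDr.
apply: eq1; apply/eqP; rewrite eq_le le1 -subr_ge0 eS; exact: addr_ge0.
Qed.

(** By [word_rigid] the pairs of letters are cells; being distinct and as many as the cells, they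
    list the diagram in some order [u]. *)
Lemma word_factor f g : injective (fun k => (f k, g k)) ->
  vander_coef (x - content f) != 0 -> vander_coef (y - content g) != 0 ->
  exists u : 'S_m, f = [ffun k => rowf (u k)] /\ g = [ffun k => colf (u k)].
Proof.
move=> fg_inj /vander_coef_neq0[w ew] /vander_coef_neq0[w' ew'].
have [_ _ fg] := word_rigid fg_inj ew ew'.
have cell k : exists l, (rowf l == f k) && (colf l == g k).
  have [l [el1 el2]] := cell_word_onto lam_part leN leM (fg k).
  by exists l; rewrite el1 el2 !eqxx.
pose u k := xchoose (cell k).
have uP k : rowf (u k) = f k /\ colf (u k) = g k.
  by have /andP[/eqP -> /eqP ->] := xchooseP (cell k).
have u_inj : injective u.
  by move=> k l e; apply: fg_inj; have [<- <-] := uP k; have [<- <-] := uP l; rewrite e.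
exists (perm u_inj); split; apply/ffunP => k; rewrite ffunE permE;
  by have [] := uP k.
Qed.

End Rigidity.

(** * Norm of the Frobenius class function *)

Definition cycle_sizes m (s : 'S_m) : seq nat :=
  [seq #|C| | C : {set 'I_m} <- enum (porbits s)].

Lemma cycle_sizes_gt0 m (s : 'S_m) : all (leq 1) (cycle_sizes s).
Proof.
apply/allP => _ /mapP[C /[!mem_enum] /imsetP[i _ ->] ->].
by rewrite lt0n card_porbit_neq0.
Qed.

Lemma sign_size_cycle_sizes (R : pzRingType) m (s : 'S_m) :
  (-1) ^+ size (cycle_sizes s) = (-1) ^+ m * (-1) ^+ s :> R.
Proof.
rewrite size_map -cardE -[LHS]signr_odd -[(-1) ^+ m]signr_odd -signr_addb.
by rewrite /odd_perm card_ord addbA addbb.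
Qed.

Lemma frob_int N eta (x : 'rV[int]_N) : frob eta x \in Num.int.
Proof.
elim: eta x => [|k eta IH] x /=; last by apply: rpred_sum => i _; apply: IH.
apply: rpred_sum => w _; apply: rpredM; first by rewrite rpred_sign.
by apply: rpred_prod => i _; rewrite mxE rpred_nat.
Qed.

Lemma fixes_word_tperm m N (f : {ffun 'I_m -> 'I_N}) k l (s : 'S_m) :
  f k = f l -> fixes_word f (tperm k l * s)%g = fixes_word f s.
Proof.
move=> fkl; have ft i : f (tperm k l i) = f i by case: tpermP => // ->.
apply/forallP/forallP => fs i; last by rewrite permM (eqP (fs _)) ft.
have := fs (tperm k l i).
by rewrite permM tpermK => /eqP ->; rewrite ft.
Qed.

(** If two places carry the same pair of letters, their transposition cancels the permutations in
    pairs; otherwise only the identity fixes both words. *)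
Lemma sum_sign_stabiliser m N M (f : {ffun 'I_m -> 'I_N}) (g : {ffun 'I_m -> 'I_M}) :
  \sum_(s | fixes_word f s && fixes_word g s) (-1) ^+ (s : 'S_m) =
  (injectiveb (fun k => (f k, g k)))%:R :> algC.
Proof.
case: injectiveP => [fg_inj|/injectiveP].
  rewrite (big_pred1 1%g) => [|s /=]; first by rewrite odd_perm1.
  apply/andP/eqP => [[/forallP fs /forallP gs]|->]; last first.
    by split; apply/forallP => k; rewrite perm1.
  apply/permP => k; rewrite perm1; apply: fg_inj.
  by rewrite (eqP (fs k)) (eqP (gs k)).
case/injectivePn => k [l kl [fkl gkl]].
set S := LHS; suff : S = - S by move/eqP; rewrite -subr_eq0 opprK -mulr2n mulrn_eq0 => /eqP.
rewrite {1}/S (reindex_inj (mulgI (tperm k l))) /= -sumrN.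
apply: eq_big => [s|s _]; first by rewrite !fixes_word_tperm.
by rewrite odd_permM odd_tperm kl signrN.
Qed.

Section Norm.
Variables (lam : seq nat) (N M : nat).
Hypotheses (lam_part : is_part lam) (leN : (size lam <= N)%N).
Hypothesis leM : (nth 0%N lam 0 <= M)%N.
Local Notation m := (sumn lam).
Local Notation x := (beta_row N (nth 0%N lam)).
Local Notation y := (beta_row M (conj_part lam)).
Local Notation rowf := (row_word leN).
Local Notation colf := (col_word lam_part leM).

Definition frob_char (s : 'S_m) : algC := frob (cycle_sizes s) x.

Lemma frob_charE s : frob_char s =
  \sum_(f : {ffun 'I_m -> 'I_N} | fixes_word f s) vander_coef (x - content f).
Proof. exact: frob_fixed_words. Qed.

Lemma frob_charV s : frob_char s^-1 = frob_char s.
Proof. by rewrite /frob_char /cycle_sizes porbitsV. Qed.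

Lemma vander_coef_rowf (u : 'S_m) :
  vander_coef (x - content [ffun k => rowf (u k)]) = 1.
Proof.
rewrite content_perm (content_row_word lam_part leN leM) -(frob0_staircase N).
by congr vander_coef; apply/rowP => i; rewrite !mxE; lia.
Qed.

Lemma vander_coef_colf (u : 'S_m) :
  vander_coef (y - content [ffun k => colf (u k)]) = 1.
Proof.
rewrite content_perm (content_col_word lam_part leN leM) -(frob0_staircase M).
by congr vander_coef; apply/rowP => i; rewrite !mxE; lia.
Qed.

Definition word_pair (u : 'S_m) : {ffun 'I_m -> 'I_N} * {ffun 'I_m -> 'I_M} :=
  ([ffun k => rowf (u k)], [ffun k => colf (u k)]).

Lemma word_pair_inj : injective word_pair.
Proof.
move=> u v [/ffunP er /ffunP ec]; apply/permP => k.
apply: (@cell_word_inj lam N M lam_part leN leM).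
by have := er k; have := ec k; rewrite !ffunE => -> ->.
Qed.

(** One factor is expanded in row words and the other, through the conjugate partition, in signed
    column words. Summing over [s] first leaves the separating pairs, and among these only the m!
    relabellings of the diagram have a nonzero coefficient, namely 1. *)
Lemma frob_char_norm : \sum_s frob_char s ^+ 2 = (m`!)%:R.
Proof.
have [c ec] := frob_conj_part lam_part leN leM.
have eq2 s : frob_char s = (-1) ^+ c * (-1) ^+ m * ((-1) ^+ s *
    \sum_(g : {ffun 'I_m -> 'I_M} | fixes_word g s) vander_coef (y - content g)).
  rewrite /frob_char ec ?cycle_sizes_gt0 // sign_size_cycle_sizes -!mulrA.
  by congr (_ * (_ * (_ * _))); apply: frob_fixed_words.
have : \sum_s frob_char s ^+ 2 = (-1) ^+ c * (-1) ^+ m * (m`!)%:R.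
  transitivity ((-1) ^+ c * (-1) ^+ m * \sum_(f : {ffun 'I_m -> 'I_N})
    \sum_(g : {ffun 'I_m -> 'I_M}) vander_coef (x - content f) *
      vander_coef (y - content g) * (injectiveb (fun k => (f k, g k)))%:R).
    pose T s f g : algC := vander_coef (x - content f) * vander_coef (y - content g) *
      (if fixes_word f s && fixes_word g s then (-1) ^+ (s : 'S_m) else 0).
    transitivity ((-1) ^+ c * (-1) ^+ m * \sum_s \sum_f \sum_g T s f g).
      rewrite mulr_sumr; apply: eq_bigr => s _.
      rewrite expr2 {1}frob_charE eq2 mulrCA; congr (_ * _).
      rewrite mulrCA big_distrlr /= mulr_sumr big_mkcond /=; apply: eq_bigr => f _.
      rewrite /T; case: ifP => _ /=; last by rewrite big1 // => g _; rewrite mulr0.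
      rewrite mulr_sumr big_mkcond /=; apply: eq_bigr => g _.
      by case: ifP => _; rewrite ?mulr0 // mulrC.
    congr (_ * _); rewrite exchange_big; apply: eq_bigr => f _ /=.
    rewrite exchange_big; apply: eq_bigr => g _ /=.
    by rewrite -mulr_sumr -big_mkcond sum_sign_stabiliser.
  congr (_ * _); rewrite pair_bigA /= (bigID (mem (word_pair @: finset.setT))) /=.
  rewrite [X in _ + X]big1 ?addr0 => [|[f g] /= nim]; last first.
    case: injectiveP => [fg_inj|_]; last by rewrite mulr0.
    rewrite mulr1; have [->|vf] := eqVneq (vander_coef (x - content f)) 0.
      by rewrite mul0r.
    have [->|vg] := eqVneq (vander_coef (y - content g)) 0; first by rewrite mulr0.
    case/negP: nim; have [u [-> ->]] := word_factor lam_part leN leM fg_inj vf vg.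
    by apply/imsetP; exists u; rewrite ?inE.
  rewrite big_imset /=; last exact: in2W word_pair_inj.
  rewrite (eq_bigr (fun=> 1)) => [|u _].
    by rewrite sumr_const cardsT card_Sn.
  rewrite vander_coef_rowf vander_coef_colf !mul1r.
  case: injectiveP => // -[] k l [].
  rewrite !ffunE => er eco; apply: (@perm_inj _ u).
  by apply: (@cell_word_inj lam N M lam_part leN leM); rewrite /= !ffunE er eco.
rewrite -[(-1) ^+ m]signr_odd -signr_addb => e.
(* The remaining global sign is settled by positivity: the left side is a sum of squares of
   integers. *)
case: (_ (+) _) e => [|->]; last by rewrite mul1r.
rewrite expr1 mulN1r => e.
have : 0 <= \sum_s frob_char s ^+ 2.
  apply: sumr_ge0 => s _; rewrite -realEsqr; apply: Rreal_int.
  exact: frob_int.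
by rewrite e oppr_ge0 lern0 -leqn0 leqNgt fact_gt0.
Qed.

End Norm.

Arguments frob_char : clear implicits.

(** * Characters of idempotents of the group algebra *)

(** An idempotent with row space [U] is a projection onto [U], so composing with it restricts the
    trace to [U]. *)
Lemma mxtrace_submod_idem (F : fieldType) (gT : finGroupType) (G : {group gT}) n
    (rG : mx_representation F G n) (U E : 'M[F]_n) (modU : mxmodule rG U) x :
  x \in G -> (U :=: E)%MS -> E *m E = E -> \tr (submod_repr modU x) = \tr (E *m rG x).
Proof.
move=> Gx UE EE.
have idE m (W : 'M_(m, n)) : (W <= U)%MS -> W *m E = W.
  by rewrite UE => /submxP[D ->]; rewrite -mulmxA EE.
set B := val_submod (U := U) 1%:M.
have BU : (B <= U)%MS by rewrite val_submodP.
have EU : (E <= U)%MS by rewrite UE.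
transitivity (\tr (B *m rG x *m in_submod U E)).
  rewrite [in_submod U E]in_submodE mulmxA -in_submodE idE //.
  by apply: mxmodule_trans.
by rewrite mxtrace_mulC mulmxA -val_submodE in_submodK.
Qed.

Section LeftRegular.
Variable gT : finGroupType.
Local Notation G := [set: gT]%G.
Local Notation n := #|[set: gT]|.
Local Notation rG := (regular_repr algC [set: gT]%G).

(** Left multiplication by [x] in the basis of the regular representation. Acting on row vectors, it
    reverses products. *)
Definition left_mx (x : gT) : 'M[algC]_n :=
  \matrix_i delta_mx 0 (gring_index [set: gT] (x * enum_val i)%g).

Lemma left_mxE x i j : left_mx x i j = (enum_val j == x * enum_val i)%g%:R.
Proof.
rewrite !mxE eqxx /=; congr (nat_of_bool _)%:R.
apply/eqP/eqP => [->|e]; first by rewrite gring_indexK ?inE.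
by rewrite -e gring_valK.
Qed.

Lemma left_mxM x y : left_mx (x * y)%g = left_mx y *m left_mx x.
Proof.
apply/row_matrixP => i.
by rewrite row_mul !rowK -rowE rowK gring_indexK ?inE // mulgA.
Qed.

Lemma tr_left_mx x : (left_mx x)^T = left_mx x^-1%g.
Proof.
apply/matrixP => i j; rewrite mxE !left_mxE; congr (nat_of_bool _)%:R.
by apply/eqP/eqP => ->; rewrite ?mulKg ?mulKVg.
Qed.

Lemma mxtrace_left_mx x : \tr (left_mx x) = (x == 1%g)%:R * n%:R.
Proof.
rewrite /mxtrace (eq_bigr (fun=> (x == 1%g)%:R)) => [|i _].
  by rewrite sumr_const card_ord mulr_natr.
rewrite left_mxE; congr (nat_of_bool _)%:R.
by rewrite -{1}[enum_val i]mul1g (inj_eq (mulIg _)) eq_sym.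
Qed.

Lemma card_gT_neq0 : n%:R != 0 :> algC.
Proof. by rewrite pnatr_eq0 -lt0n cardG_gt0. Qed.

Lemma sum_gring_index (V : nmodType) (F : gT -> V) :
  \sum_(i < n) F (enum_val i) = \sum_h F h.
Proof.
rewrite [RHS](reindex (@enum_val gT (mem [set: gT]))) /=; last first.
  exists (gring_index [set: gT]) => [i _|h _]; first exact: gring_valK.
  by rewrite gring_indexK ?inE.
by [].
Qed.

(** The map v -> x v g fixes v exactly when v g v^-1 = x^-1, so the trace counts conjugates of
    [g]. *)
Lemma mxtrace_left_right x g : \tr (left_mx x *m rG g) * n%:R =
  \sum_h \tr (left_mx x *m left_mx (h * g * h^-1)%g).
Proof.
rewrite -(sum_gring_index (fun h => \tr (left_mx x *m left_mx (h * g * h^-1)%g))).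
rewrite mulr_suml; apply: eq_bigr => i _.
rewrite -left_mxM mxtrace_left_mx; congr (_ * _).
have -> : (left_mx x *m rG g) i i = row i (left_mx x *m rG g) 0 i by rewrite [RHS]mxE.
rewrite row_mul rowK -rowE rowK gring_indexK ?inE // mxE eqxx; congr (nat_of_bool _)%:R.
rewrite -(inj_eq enum_val_inj) gring_indexK ?inE // mulg_eq1.
set v := enum_val i; apply/eqP/eqP => [e|e].
  by apply: (mulgI x); rewrite mulgV !mulgA -e mulgV.
by rewrite -[v in LHS](mulKVg x) -e mulgKV mulgA.
Qed.

Definition in_left_span (X : 'M[algC]_n) : Prop :=
  exists c : gT -> algC, X = \sum_g c g *: left_mx g.

(** The trace of [left_mx] vanishes off the identity, so traces against group elements read off the
    coefficients. *)
Lemma left_span_inversion X : in_left_span X ->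
  \sum_g \tr (X *m left_mx g) *: left_mx g^-1%g = n%:R *: X.
Proof.
case=> c ->; rewrite scaler_sumr.
under eq_bigr => g _.
  rewrite mulmx_suml linear_sum scaler_suml /=.
  over.
rewrite exchange_big; apply: eq_bigr => x _ /=.
rewrite (bigD1 x^-1%g) //= big1 ?addr0 => [|g gx].
  rewrite -scalemxAl linearZ /= -left_mxM mulVg mxtrace_left_mx eqxx mul1r invgK.
  by rewrite scalerA mulrC.
rewrite -scalemxAl linearZ /= -left_mxM mxtrace_left_mx.
by rewrite mulg_eq1 (negbTE gx) mul0r mulr0 scale0r.
Qed.

Section Idempotent.
Variable e : 'M[algC]_n.
Hypotheses (e_span : in_left_span e) (ee : e *m e = e) (tr_e : \tr e != 0).

Definition idem_char (g : gT) : algC := \tr (e *m rG g).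

Lemma idem_charE g : idem_char g * n%:R = \sum_h \tr (e *m left_mx (h * g * h^-1)%g).
Proof.
case: e_span => c ec; rewrite /idem_char ec mulmx_suml linear_sum mulr_suml /=.
under [RHS]eq_bigr do rewrite mulmx_suml linear_sum /=.
rewrite exchange_big; apply: eq_bigr => x _ /=.
under [RHS]eq_bigr do rewrite -scalemxAl linearZ /=.
by rewrite -mulr_sumr -mxtrace_left_right -scalemxAl linearZ /= mulrA.
Qed.

Lemma idem_charJ g k : idem_char (k * g * k^-1)%g = idem_char g.
Proof.
apply: (mulIf card_gT_neq0); rewrite !idem_charE [RHS](reindex_inj (mulIg k)) /=.
by apply: eq_bigr => h _; rewrite invMg !mulgA.
Qed.

(** Averaging over conjugates turns the sum into traces of e h Y h^-1. As e h Y is a multiple of e,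
    such a trace times tr e is tr(e h Y) tr(e h^-1), and [left_span_inversion] then carries out the
    sum over h. *)
Lemma idem_char_sum (y : gT -> algC) (Y := \sum_s y s *: left_mx s) (a : algC) :
  e *m Y = a *: e -> (forall h, exists t, e *m left_mx h *m Y = t *: e) ->
  \sum_s y s * idem_char s = a.
Proof.
move=> eY eLY; apply: (mulIf card_gT_neq0); rewrite mulr_suml.
transitivity (\sum_h \tr (e *m left_mx h *m Y *m left_mx h^-1%g)).
  rewrite [RHS](reindex_inj invg_inj) /=.
  under [RHS]eq_bigr => h _.
    rewrite invgK mulmx_sumr mulmx_suml linear_sum /=.
    over.
  rewrite exchange_big; apply: eq_bigr => s _ /=.
  rewrite -mulrA idem_charE mulr_sumr; apply: eq_bigr => h _.
  by rewrite -scalemxAr -scalemxAl linearZ /= !left_mxM !mulmxA.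
apply: (mulIf tr_e); rewrite mulr_suml.
transitivity (\sum_h \tr (e *m left_mx h *m Y) * \tr (e *m left_mx h^-1%g)).
  apply: eq_bigr => h _; have [t ->] := eLY h.
  by rewrite -scalemxAl !linearZ /= mulrAC.
transitivity (\tr (Y *m e *m \sum_h \tr (e *m left_mx h) *: left_mx h^-1%g)).
  rewrite mulmx_sumr linear_sum (reindex_inj invg_inj) /=; apply: eq_bigr => h _.
  rewrite invgK -scalemxAr linearZ /= mulrC; congr (_ * _).
  by rewrite mxtrace_mulC mulmxA.
rewrite left_span_inversion // -scalemxAr -mulmxA ee linearZ /= mxtrace_mulC eY linearZ /=.
by rewrite mulrCA mulrA.
Qed.

(** The case Y = e of [idem_char_sum], the coefficients of [e] being given by
    [left_span_inversion]. *)
Lemma idem_char_norm : (forall h, exists t, e *m left_mx h *m e = t *: e) ->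
  \sum_g idem_char g * idem_char g^-1%g = n%:R.
Proof.
move=> eLe; have := left_span_inversion e_span => inv.
have eE : e = \sum_s (n%:R^-1 * \tr (e *m left_mx s^-1%g)) *: left_mx s.
  transitivity ((n%:R^-1 * n%:R) *: e); first by rewrite mulVf ?card_gT_neq0 ?scale1r.
  rewrite -scalerA -inv scaler_sumr.
  rewrite (reindex_inj invg_inj) /=; apply: eq_bigr => s _.
  by rewrite scalerA invgK.
have := @idem_char_sum (fun s => n%:R^-1 * \tr (e *m left_mx s^-1%g)) 1.
rewrite -eE scale1r => /(_ ee eLe) sum1.
apply: (mulIf card_gT_neq0).
transitivity (\sum_h \sum_g \tr (e *m left_mx (h * g * h^-1)%g) * idem_char g^-1%g).
  rewrite [RHS]exchange_big mulr_suml; apply: eq_bigr => g _ /=.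
  by rewrite -mulr_suml -idem_charE mulrAC.
rewrite (eq_bigr (fun=> n%:R)) => [|h _].
  by rewrite sumr_const -cardsT mulr_natr.
transitivity (\sum_g \tr (e *m left_mx g) * idem_char g^-1%g).
  rewrite [RHS](reindex_inj (conjg_inj h^-1%g)) /=; apply: eq_bigr => g _.
  by rewrite -conjVg !conjgE invgK !mulgA idem_charJ.
rewrite -[RHS]mulr1 -[X in _ = _ * X]sum1 mulr_sumr (reindex_inj invg_inj) /=.
by apply: eq_bigr => g _; rewrite !mulrA mulfV ?card_gT_neq0 // mul1r invgK.
Qed.

End Idempotent.

End LeftRegular.

Section LeftSpan.
Variable gT : finGroupType.

Lemma left_span_sum (P : pred gT) (c : gT -> algC) :
  in_left_span (\sum_(s | P s) c s *: left_mx s).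
Proof.
exists (fun s => if P s then c s else 0); rewrite big_mkcond; apply: eq_bigr => s _.
by case: (P s); rewrite ?scale0r.
Qed.

Lemma left_span_scale (X : 'M[algC]_#|[set: gT]|) (a : algC) :
  in_left_span X -> in_left_span (a *: X).
Proof.
case=> c ->; exists (fun s => a * c s); rewrite scaler_sumr.
by apply: eq_bigr => s _; rewrite scalerA.
Qed.

Lemma left_span_mul (X Y : 'M[algC]_#|[set: gT]|) :
  in_left_span X -> in_left_span Y -> in_left_span (X *m Y).
Proof.
case=> c -> [d ->]; exists (fun k => \sum_g c g * d (k * g^-1)%g).
under [RHS]eq_bigr do rewrite scaler_suml.
rewrite exchange_big mulmx_suml; apply: eq_bigr => g _ /=.
rewrite mulmx_sumr [RHS](reindex_inj (mulIg g)) /=; apply: eq_bigr => h _.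
by rewrite mulgK left_mxM -scalemxAl -scalemxAr scalerA.
Qed.

Lemma left_span_scalar (A B C X : 'M[algC]_#|[set: gT]|) :
  (forall h, exists t : algC, A *m left_mx h *m B = t *: C) ->
  in_left_span X -> exists t : algC, A *m X *m B = t *: C.
Proof.
move=> /choice[t tE] [c ->].
exists (\sum_h c h * t h); rewrite mulmx_sumr mulmx_suml scaler_suml.
apply: eq_bigr => h _; rewrite -scalemxAr -scalemxAl.
by rewrite tE scalerA.
Qed.

End LeftSpan.

Lemma real_mx_gram_eq0 m n (X : 'M[algC]_(m, n)) :
  X \is a mxOver Num.real -> X^T *m X = 0 -> X = 0.
Proof.
move=> /mxOverP Xr XX; apply/matrixP => i j; rewrite mxE.
have := congr1 (fun Y : 'M_n => Y j j) XX; rewrite !mxE => /eqP.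
rewrite psumr_eq0 => [|k _]; last by rewrite mxE -expr2 -realEsqr Xr.
by move=> /allP/(_ i (mem_index_enum _)); rewrite mxE -expr2 sqrf_eq0 => /eqP.
Qed.

(** Positivity of Gram matrices, used for A B A and then for B A: each Gram matrix is a combination
    already known to vanish. It shows that the Young symmetrizer does not square to 0. *)
Lemma sym_mul_square_eq0 n (A B : 'M[algC]_n) (p q : algC) :
    A \is a mxOver Num.real -> B \is a mxOver Num.real ->
    A^T = A -> B^T = B -> A *m A = p *: A -> B *m B = q *: B ->
  B *m A *m (B *m A) = 0 -> B *m A = 0.
Proof.
move=> rA rB tA tB AA BB BABA.
have ABA : A *m B *m A = 0.
  apply: real_mx_gram_eq0; first by rewrite !mxOverM.
  rewrite !trmx_mul tA tB !mulmxA -(mulmxA (A *m B) A A) AA.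
  rewrite -scalemxAr -!scalemxAl -!mulmxA (mulmxA B A) BABA.
  by rewrite mulmx0 scaler0.
apply: real_mx_gram_eq0; first by rewrite mxOverM.
rewrite !trmx_mul tA tB !mulmxA -(mulmxA A B B) BB.
by rewrite -scalemxAr -!scalemxAl ABA scaler0.
Qed.

(** * Row and column sums in the group algebra *)

Section FixesWord.
Variables (m N : nat) (f : {ffun 'I_m -> 'I_N}).
Implicit Types s t : 'S_m.

Lemma fixes_wordMl s t : fixes_word f s -> fixes_word f (s * t)%g = fixes_word f t.
Proof.
move=> /forallP fs; apply/forallP/forallP => h i; last first.
  by rewrite permM (eqP (h _)) (eqP (fs _)).
by have := h (s^-1 i)%g; rewrite permM permKV => /eqP ->; have := fs (s^-1 i)%g; rewrite permKV eq_sym.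
Qed.

Lemma fixes_word1 : fixes_word f 1%g.
Proof. by apply/forallP => i; rewrite perm1. Qed.

Lemma fixes_wordV s : fixes_word f s^-1%g = fixes_word f s.
Proof.
by apply/idP/idP => h; rewrite -(fixes_wordMl _ h) ?mulgV ?mulVg fixes_word1.
Qed.

Lemma fixes_wordMr s t : fixes_word f t -> fixes_word f (s * t)%g = fixes_word f s.
Proof. by move=> ft; rewrite -fixes_wordV invMg fixes_wordMl fixes_wordV. Qed.

End FixesWord.

Section WordSums.
Variables (m N M : nat).
Implicit Types (f : {ffun 'I_m -> 'I_N}) (g : {ffun 'I_m -> 'I_M}) (s : 'S_m).

Definition row_sum f := \sum_(s | fixes_word f s) left_mx s.
Definition col_sum g := \sum_(s | fixes_word g s) (-1) ^+ (s : 'S_m) *: left_mx s.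

Lemma left_mx_row_sum f p : fixes_word f p -> left_mx p *m row_sum f = row_sum f.
Proof.
move=> fp; rewrite /row_sum [RHS](reindex_inj (mulIg p)) mulmx_sumr /=.
by apply: eq_big => s; rewrite ?left_mxM // fixes_wordMr.
Qed.

Lemma col_sum_left_mx g q : fixes_word g q ->
  col_sum g *m left_mx q = (-1) ^+ q *: col_sum g.
Proof.
move=> fq; rewrite /col_sum [in RHS](reindex_inj (mulgI q)) mulmx_suml scaler_sumr /=.
apply: eq_big => [s|s _]; first by rewrite fixes_wordMl.
by rewrite left_mxM -scalemxAl scalerA odd_permM signr_addb mulrA -expr2 sqrr_sign mul1r.
Qed.

Lemma tr_row_sum f : (row_sum f)^T = row_sum f.
Proof.
rewrite /row_sum linear_sum (reindex_inj invg_inj) /=.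
by apply: eq_big => s; rewrite ?fixes_wordV // tr_left_mx invgK.
Qed.

Lemma tr_col_sum g : (col_sum g)^T = col_sum g.
Proof.
rewrite /col_sum linear_sum (reindex_inj invg_inj) /=.
by apply: eq_big => s; rewrite ?fixes_wordV // linearZ /= tr_left_mx invgK odd_permV.
Qed.

Lemma row_sum_sqr f : row_sum f *m row_sum f = #|[pred s | fixes_word f s]|%:R *: row_sum f.
Proof.
rewrite {1}/row_sum mulmx_suml (eq_bigr (fun=> row_sum f)) => [|p]; last exact: left_mx_row_sum.
by rewrite sumr_const scaler_nat.
Qed.

Lemma col_sum_sqr g : col_sum g *m col_sum g = #|[pred s | fixes_word g s]|%:R *: col_sum g.
Proof.
rewrite {2}/col_sum mulmx_sumr (eq_bigr (fun=> col_sum g)) => [|q gq].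
  by rewrite sumr_const scaler_nat.
by rewrite -scalemxAr col_sum_left_mx // scalerA -expr2 sqrr_sign scale1r.
Qed.

Lemma row_sum_span f : in_left_span (row_sum f).
Proof.
have -> : row_sum f = \sum_(s | fixes_word f s) 1 *: left_mx s.
  by apply: eq_bigr => s _; rewrite scale1r.
exact: left_span_sum.
Qed.

Lemma col_sum_span g : in_left_span (col_sum g).
Proof. exact: left_span_sum. Qed.

Lemma row_sum_real f : row_sum f \is a mxOver Num.real.
Proof.
by apply/mxOverP => i j; rewrite summxE; apply: rpred_sum => s _; rewrite left_mxE rpred_nat.
Qed.

Lemma col_sum_real g : col_sum g \is a mxOver Num.real.
Proof.
apply/mxOverP => i j; rewrite summxE; apply: rpred_sum => s _.
by rewrite mxE left_mxE rpredM ?rpred_sign ?rpred_nat.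
Qed.

(** The transposition of [k] and [l] is absorbed by the row sum; moved across [h] it becomes a
    transposition absorbed by the column sum with a sign, so the product equals its opposite. *)
Lemma col_row_sum_eq0 f g (h : 'S_m) k l : k != l -> f k = f l -> g (h k) = g (h l) ->
  col_sum g *m left_mx h *m row_sum f = 0.
Proof.
move=> kl fkl gkl; set X := LHS.
have ft : fixes_word f (tperm k l).
  by apply/forallP => i; case: tpermP => [->|->|//]; rewrite ?fkl.
have gt : fixes_word g (tperm k l ^ h)%g.
  by rewrite tpermJ; apply/forallP => i; case: tpermP => [->|->|//]; rewrite ?gkl.
have : X = - X.
  rewrite /X -{1}(left_mx_row_sum ft) mulmxA -[_ *m _ *m left_mx _]mulmxA -left_mxM.
  have -> : (tperm k l * h = h * tperm k l ^ h)%g by rewrite conjgE mulKVg.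
  rewrite left_mxM mulmxA (col_sum_left_mx gt) odd_permJ odd_tperm kl expr1.
  by rewrite -!scalemxAl scaleN1r.
move/eqP; rewrite -subr_eq0 opprK -mulr2n -scaler_nat scaler_eq0 pnatr_eq0 /=.
by move/eqP.
Qed.

End WordSums.

(** * Specht characters *)

Section Specht.
Variables (lam : seq nat) (N M : nat).
Hypotheses (lam_part : is_part lam) (leN : (size lam <= N)%N).
Hypothesis leM : (nth 0%N lam 0 <= M)%N.
Local Notation m := (sumn lam).
Local Notation x := (beta_row N (nth 0%N lam)).
Local Notation y := (beta_row M (conj_part lam)).
Local Notation rowf := (row_word leN).
Local Notation colf := (col_word lam_part leM).
Local Notation n := #|[set: 'S_m]|.

Let a := row_sum rowf.
Let b := col_sum colf.

Lemma row_stableE p : row_stable p = fixes_word rowf p.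
Proof. by apply: eq_forallb => i; rewrite !ffunE -val_eqE. Qed.

Lemma col_stableE q : col_stable q = fixes_word colf q.
Proof. by apply: eq_forallb => i; rewrite !ffunE -val_eqE. Qed.

(* Left multiplications compose in reverse order, so this is the left *)
(* multiplication by the Young symmetrizer.                           *)
Definition young_mx : 'M[algC]_n := b *m a.

Lemma young_mxE : young_mx =
  \sum_(p | row_stable p) \sum_(q | col_stable q) (-1) ^+ odd_perm q *: left_mx (p * q)%g.
Proof.
rewrite /young_mx /b /col_sum mulmx_suml exchange_big; apply: eq_big => q.
  by rewrite col_stableE.
move=> _; rewrite -scalemxAl -scaler_sumr mulmx_sumr; congr (_ *: _).
by apply: eq_big => p; rewrite ?row_stableE // left_mxM.
Qed.

Lemma fixes_cell_words p : fixes_word rowf p -> fixes_word colf p -> p = 1%g.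
Proof.
move=> /forallP rp /forallP cp; apply/permP => k; rewrite perm1.
by apply: (@cell_word_inj lam N M lam_part leN leM); rewrite (eqP (rp k)) (eqP (cp k)).
Qed.

(** The row and column groups meet trivially, so the identity of the group arises only from p = q =
    1. *)
Lemma mxtrace_young_mx : \tr young_mx = n%:R.
Proof.
rewrite young_mxE linear_sum (bigD1 1%g) /=; last by rewrite row_stableE fixes_word1.
rewrite [X in _ + X]big1 ?addr0 => [|p /andP[rp p1]]; last first.
  rewrite linear_sum big1 //= => q cq.
  rewrite linearZ /= mxtrace_left_mx; case: eqP => [pq|_]; last by rewrite mul0r mulr0.
  case/eqP: p1; apply: fixes_cell_words; first by rewrite -row_stableE.
  by rewrite -fixes_wordV -col_stableE (_ : p^-1 = q)%g //; apply: mulg1_eq.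
rewrite linear_sum (bigD1 1%g) /=; last by rewrite col_stableE fixes_word1.
rewrite big1 ?addr0 => [|q /andP[_ q1]]; last first.
  by rewrite linearZ /= mxtrace_left_mx mul1g (negbTE q1) mul0r mulr0.
by rewrite linearZ /= mxtrace_left_mx mulg1 eqxx mul1r odd_perm1 mul1r.
Qed.

Lemma young_mx_span : in_left_span young_mx.
Proof. by apply: left_span_mul; [apply: col_sum_span | apply: row_sum_span]. Qed.

(* Von Neumann's lemma: either [h] factors through the row and column groups, *)
(* or some transposition of the row group is conjugated by [h] into the       *)
(* column group, and the product vanishes.                                    *)
Lemma young_mx_left h : exists t : algC, b *m left_mx h *m a = t *: young_mx.
Proof.
pose g : {ffun 'I_m -> 'I_M} := [ffun k => colf (h k)].
have [fg_inj|] := injectiveP (fun k => (rowf k, g k)); last first.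
  move/injectiveP/injectivePn => [k [l kl [ekl]]]; rewrite [LHS]ffunE [RHS]ffunE => gkl.
  exists 0; rewrite scale0r.
  apply: col_row_sum_eq0 kl ekl gkl.
have vf : vander_coef (x - content rowf) != 0.
  have := vander_coef_rowf lam_part leN leM 1%g; rewrite content_perm => ->.
  exact: oner_neq0.
have vg : vander_coef (y - content g) != 0.
  by rewrite (vander_coef_colf lam_part leN) oner_eq0.
(* Comparison of the row words puts [u] in the row group, and comparison of the column words puts
   [u^-1 * h] in the column group. *)
have [u [/ffunP eu /ffunP ev]] := word_factor lam_part leN leM fg_inj vf vg.
have ru : fixes_word rowf u by apply/forallP => k; rewrite [X in _ == X]eu [X in _ == X]ffunE.
have cu : fixes_word colf (u^-1 * h)%g.
  apply/forallP => k; rewrite permM.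
  have := ev (u^-1 k)%g; rewrite [LHS]ffunE [RHS]ffunE permKV => ->.
  by [].
exists ((-1) ^+ (u^-1 * h)%g).
have -> : h = (u * (u^-1 * h))%g by rewrite mulKVg.
rewrite left_mxM mulmxA (col_sum_left_mx cu) -!scalemxAl -mulmxA left_mx_row_sum //.
by rewrite mulKVg.
Qed.

Lemma young_mx_span_scale X : in_left_span X -> exists t : algC, b *m X *m a = t *: young_mx.
Proof. exact: left_span_scalar young_mx_left. Qed.

Lemma young_mx_neq0 : young_mx != 0.
Proof.
apply: contraTneq isT => C0; have := mxtrace_young_mx; rewrite C0 linear0 => /esym/eqP.
by rewrite (negbTE (card_gT_neq0 _)).
Qed.

(** The square is b (a b) a, a multiple of b a by von Neumann's lemma; the factor is nonzero by
    [sym_mul_square_eq0]. *)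
Lemma young_mx_sqr : exists2 k : algC, k != 0 & young_mx *m young_mx = k *: young_mx.
Proof.
have [|k ek] := @young_mx_span_scale (a *m b).
  by apply: left_span_mul; [apply: row_sum_span | apply: col_sum_span].
have {}ek : young_mx *m young_mx = k *: young_mx by rewrite -ek /young_mx !mulmxA.
exists k => //; apply: contra_neq young_mx_neq0 => k0.
move: ek; rewrite k0 scale0r.
apply: sym_mul_square_eq0; rewrite ?tr_row_sum ?tr_col_sum ?row_sum_sqr ?col_sum_sqr //.
- exact: row_sum_real.
- exact: col_sum_real.
Qed.

End Specht.

(** * Frobenius' character formula *)

Section Frobenius_formula.
Variables (lam : seq nat) (N M : nat).
Hypotheses (lam_part : is_part lam) (leN : (size lam <= N)%N).
Hypothesis leM : (nth 0%N lam 0 <= M)%N.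
Local Notation m := (sumn lam).
Local Notation x := (beta_row N (nth 0%N lam)).
Local Notation rowf := (row_word leN).
Local Notation colf := (col_word lam_part leM).
Local Notation n := #|[set: 'S_m]|.
Local Notation rG := (regular_repr algC [set: 'S_m]%G).
Local Notation young := (young_mx lam_part leN leM).

(** The row of [young] indexed by s is the Young symmetrizer acted upon by s, so the rows span the
    cyclic module. *)
Lemma cyclic_young_mx : (cyclic_mx rG (young_symmetrizer lam) :=: young)%MS.
Proof.
apply: eqmx_trans (genmxE _) _.
suff -> : enveloping_algebra_mx rG *m lin_mul_row (young_symmetrizer lam) = young by [].
apply/row_matrixP => i; rewrite row_mul rowK mul_rV_lin1 /= mxvecK.
rewrite young_mxE linear_sum mulmx_suml; apply: eq_bigr => p _ /=.
rewrite linear_sum mulmx_suml; apply: eq_bigr => q _ /=.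
rewrite linearZ /= -scalemxAl rowK -rowE rowK gring_indexK ?inE //.
Qed.

Variable k : algC.
Hypotheses (k0 : k != 0) (young2 : young *m young = k *: young).

Let e := k^-1 *: young.

Lemma young_idem : e *m e = e.
Proof.
by rewrite /e -scalemxAl -scalemxAr young2 !scalerA -mulrA mulVf // mulr1.
Qed.

Lemma young_idem_span : in_left_span e.
Proof. exact/left_span_scale/young_mx_span. Qed.

Lemma young_idem_tr : \tr e != 0.
Proof.
by rewrite /e linearZ /= mxtrace_young_mx mulf_neq0 ?invr_eq0 ?card_gT_neq0.
Qed.

Lemma young_idem_row_sum X : in_left_span X ->
  exists t : algC, e *m X *m row_sum rowf = t *: e.
Proof.
move=> sX; have [|t et] := @young_mx_span_scale _ _ _ lam_part leN leM (row_sum rowf *m X).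
  by apply: left_span_mul => //; apply: row_sum_span.
exists t; rewrite /e -!scalemxAl scalerA mulrC -scalerA; congr (_ *: _).
by rewrite -et /young_mx !mulmxA.
Qed.

Lemma young_idem_right X : in_left_span X -> exists t : algC, e *m X *m e = t *: e.
Proof.
move=> sX; have [|t et] := @young_idem_row_sum (X *m col_sum colf).
  by apply: left_span_mul => //; apply: col_sum_span.
exists (k^-1 * t); rewrite -scalerA -et {2}/e /young_mx -!scalemxAr.
by rewrite !mulmxA.
Qed.

Lemma left_mx_span (s : 'S_m) : in_left_span (left_mx s).
Proof.
exists (fun g => (g == s)%:R); rewrite (bigD1 s) //= eqxx scale1r big1 ?addr0 // => g.
by move/negbTE ->; rewrite scale0r.
Qed.

Lemma specht_charE s : specht_char lam s = idem_char e s.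
Proof.
rewrite cfunE inE mulr1n; apply: mxtrace_submod_idem; rewrite ?inE //.
  apply: eqmx_trans cyclic_young_mx (eqmx_sym _).
  by apply: eqmx_scale; rewrite invr_eq0.
exact: young_idem.
Qed.

Lemma specht_char_norm : \sum_s specht_char lam s * specht_char lam s^-1%g = n%:R.
Proof.
rewrite -(idem_char_norm young_idem_span young_idem young_idem_tr) => [|h].
  by apply: eq_bigr => s _; rewrite !specht_charE.
by apply: young_idem_right; apply: left_mx_span.
Qed.

(** The row sum multiplies [e] by the order of the row group, so [idem_char_sum] applies. *)
Lemma specht_char_row_sum :
  \sum_(p | fixes_word rowf p) specht_char lam p = #|[pred p | fixes_word rowf p]|%:R.
Proof.
pose y p : algC := (fixes_word rowf p)%:R.
have Y : \sum_s y s *: left_mx s = row_sum rowf.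
  rewrite [RHS]big_mkcond; apply: eq_bigr => s _; rewrite /y.
  by case: fixes_word; rewrite ?scale1r ?scale0r.
have eY : e *m (\sum_s y s *: left_mx s) = #|[pred p | fixes_word rowf p]|%:R *: e.
  by rewrite Y /e /young_mx -scalemxAl -mulmxA row_sum_sqr -scalemxAr scalerA mulrC -scalerA.
have eLY h : exists t, e *m left_mx h *m (\sum_s y s *: left_mx s) = t *: e.
  by rewrite Y; apply: young_idem_row_sum; apply: left_mx_span.
have <- := idem_char_sum young_idem_span young_idem young_idem_tr eY eLY.
rewrite big_mkcond; apply: eq_bigr => s _; rewrite specht_charE /y.
by case: fixes_word; rewrite ?mul1r ?mul0r.
Qed.

Lemma specht_char_row_sum_conj (u : 'S_m) (f := [ffun i => rowf (u i)]) :
  \sum_(p | fixes_word f p) specht_char lam p = #|[pred p | fixes_word rowf p]|%:R.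
Proof.
rewrite -specht_char_row_sum (reindex_inj (conjg_inj u^-1%g)) /=.
apply: eq_big => p; last by rewrite cfunJ ?inE.
apply/forallP/forallP => h i.
  have := h (u^-1 i)%g; rewrite [X in X == _]ffunE [X in _ == X]ffunE.
  by rewrite conjgE invgK !permM !permKV.
rewrite [X in X == _]ffunE [X in _ == X]ffunE conjgE invgK !permM permKV.
exact: h.
Qed.

(** By [word_factor] the word [f] cannot be separated by any translate of the column word. So the
    row sum of [f], a group element and the column sum multiply to 0, and every trace making up the
    character sum contains this product. *)
Lemma specht_char_row_sum_eq0 f : vander_coef (x - content f) != 0 ->
  (forall u : 'S_m, f != [ffun i => rowf (u i)]) ->
  \sum_(p | fixes_word f p) specht_char lam p = 0.
Proof.
move=> vf nf; apply: (mulIf (card_gT_neq0 'S_m)); rewrite mul0r mulr_suml.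
rewrite (eq_bigr (fun p => \sum_h \tr (e *m left_mx (h * p * h^-1)%g))) => [|p _]; last first.
  by rewrite specht_charE (idem_charE young_idem_span).
rewrite exchange_big big1 //= => h _.
transitivity (\tr (e *m left_mx h^-1%g *m row_sum f *m left_mx h)).
  rewrite /row_sum mulmx_sumr mulmx_suml linear_sum /=; apply: eq_bigr => p _.
  by rewrite !left_mxM !mulmxA.
suff fb : row_sum f *m left_mx h *m col_sum colf = 0.
  rewrite /e /young_mx -!scalemxAl linearZ /= -!mulmxA mxtrace_mulC !mulmxA.
  by rewrite -!(mulmxA _ (row_sum f)) -!mulmxA (mulmxA (row_sum f)) fb !mulmx0 linear0 mulr0.
apply: trmx_inj; rewrite !trmx_mul trmx0 tr_row_sum tr_col_sum tr_left_mx mulmxA.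
pose g : {ffun 'I_m -> 'I_M} := [ffun i => colf (h^-1 i)%g].
have [fg_inj|] := injectiveP (fun i => (f i, g i)); last first.
  move/injectiveP/injectivePn => [i [j ij [eij]]].
  rewrite [LHS]ffunE [RHS]ffunE => gij.
  exact: col_row_sum_eq0 ij eij gij.
have vg : vander_coef (beta_row M (conj_part lam) - content g) != 0.
  by rewrite (vander_coef_colf lam_part leN) oner_eq0.
have [u [ef _]] := word_factor lam_part leN leM fg_inj vf vg.
by case/eqP: (nf u).
Qed.

(** Expanded in words, only relabellings of the row word contribute. Each has coefficient 1 and
    contributes the order of the row group, which is also the number of permutations yielding that
    word. *)
Lemma frob_specht_pairing :
  \sum_s frob_char lam N s * specht_char lam s = n%:R.
Proof.
pose H (f : {ffun 'I_m -> 'I_N}) := \sum_(p | fixes_word f p) specht_char lam p.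
transitivity (\sum_(f : {ffun 'I_m -> 'I_N}) vander_coef (x - content f) * H f).
  under eq_bigr do rewrite frob_charE mulr_suml big_mkcond /=.
  rewrite exchange_big; apply: eq_bigr => f _ /=.
  by rewrite mulr_sumr [RHS]big_mkcond.
pose w (u : 'S_m) : {ffun 'I_m -> 'I_N} := [ffun i => rowf (u i)].
pose P := #|[pred p | fixes_word rowf p]|.
have P0 : P%:R != 0 :> algC.
  by rewrite pnatr_eq0 -lt0n; apply/card_gt0P; exists 1%g; rewrite inE fixes_word1.
rewrite (bigID (mem (codom w))) /= [X in _ + X]big1 ?addr0 => [|f nf]; last first.
  have [->|vf] := eqVneq (vander_coef (x - content f)) 0; first by rewrite mul0r.
  rewrite /H specht_char_row_sum_eq0 ?mulr0 // => u.
  by apply: contraNneq nf => ->; apply: codom_f.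
apply: (mulfI P0); rewrite mulr_sumr.
transitivity (\sum_(u : 'S_m) (P%:R : algC)); last first.
  by rewrite sumr_const -cardsT mulr_natr.
rewrite (partition_big w (mem (codom w))) /= => [|u _]; last exact: codom_f.
apply: eq_bigr => _ /codomP[u ->].
rewrite (vander_coef_rowf lam_part leN leM) mul1r /H specht_char_row_sum_conj -/P.
rewrite sumr_const -[RHS]mulr_natr; congr (_ * _%:R); rewrite /P -!sum1_card [RHS](reindex_inj (mulgI u)).
apply: eq_bigl => p; have -> : (p \in [pred p | fixes_word rowf p]) = fixes_word rowf p by [].
rewrite -[RHS]/(w (u * p)%g == w u); apply/forallP/eqP => [h|h i].
  apply/ffunP => i; rewrite [LHS]ffunE [RHS]ffunE permM; exact/eqP.
have := congr1 (fun v : {ffun 'I_m -> 'I_N} => v (u^-1 i)%g) h.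
by rewrite [LHS]ffunE [RHS]ffunE permM permKV => ->.
Qed.

(** Both norms and the pairing equal the group order, so the squared distance between the two
    functions is 0. *)
Lemma specht_char_frob s : specht_char lam s = frob_char lam N s.
Proof.
have Dconj g : (frob_char lam N g - specht_char lam g)^* =
    frob_char lam N g - specht_char lam g^-1%g.
  have -> : specht_char lam g^-1%g = (specht_char lam g)^*.
    by apply: char_inv; apply: cfRepr_char.
  rewrite rmorphB /=; congr (_ - _).
  by apply/CrealP; rewrite Rreal_int // frob_int.
have D0 : \sum_g `|frob_char lam N g - specht_char lam g| ^+ 2 = 0.
  under eq_bigr do rewrite normCK Dconj mulrBl !mulrBr.
  rewrite !sumrB .
  have -> : \sum_g frob_char lam N g * frob_char lam N g = n%:R :> algC.
    rewrite cardsT card_Sn -(frob_char_norm lam_part leN leM).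
    by apply: eq_bigr => g _; rewrite expr2.
  have -> : \sum_g frob_char lam N g * specht_char lam g^-1%g = n%:R.
    rewrite -frob_specht_pairing (reindex_inj invg_inj) /=.
    by apply: eq_bigr => g _; rewrite invgK frob_charV.
  under [X in _ - (X - _)]eq_bigr do rewrite mulrC.
  by rewrite frob_specht_pairing specht_char_norm !subrr.
move/eqP: D0; rewrite psumr_eq0 => [/allP/(_ s (mem_index_enum _))|g _]; last first.
  by rewrite exprn_ge0.
by rewrite sqrf_eq0 normr_eq0 subr_eq0 => /eqP.
Qed.

End Frobenius_formula.

(** * Permutations with a given cycle type *)

Section CycleType.
Variable eta : seq nat.
Hypothesis eta_gt0 : all (leq 1) eta.
Local Notation m := (sumn eta).
Local Notation blk := (reshape_index eta).
Local Notation off := (reshape_offset eta).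

Let len (i : 'I_m) := nth 0%N eta (blk i).

Lemma off_lt (i : 'I_m) : (off i < len i)%N.
Proof. exact: reshape_offsetP (ltn_ord i). Qed.

Lemma next_subproof (i : 'I_m) : ((off i).+1 %% len i < nth 0%N eta (blk i))%N.
Proof. by rewrite ltn_mod (leq_ltn_trans _ (off_lt i)). Qed.

(** Cyclic rotation inside each of the consecutive blocks of lengths [eta]; its cycles are these
    blocks. *)
Definition block_next (i : 'I_m) : 'I_m := Ordinal (flatten_indexP (next_subproof i)).

Lemma blk_next i : blk (block_next i) = blk i.
Proof. exact: flatten_indexKl (next_subproof i). Qed.

Lemma off_next i : off (block_next i) = ((off i).+1 %% len i)%N.
Proof. exact: flatten_indexKr (next_subproof i). Qed.

Lemma block_eq (i j : 'I_m) : blk i = blk j -> off i = off j -> i = j.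
Proof.
by move=> eb eo; apply/val_inj; rewrite /= -(reshape_indexK eta i) -(reshape_indexK eta j) eb eo.
Qed.

Lemma block_next_inj : injective block_next.
Proof.
move=> i j e; have eb : blk i = blk j by rewrite -blk_next e blk_next.
apply: block_eq => //; have := congr1 (fun k : 'I_m => off k) e; rewrite /= !off_next.
have el : len i = len j by rewrite /len eb.
have := off_lt i; have := off_lt j; rewrite -el => lj li /eqP.
by rewrite -[(off i).+1]addn1 -[(off j).+1]addn1 eqn_modDr !modn_small // => /eqP.
Qed.

Definition block_perm : 'S_m := perm block_next_inj.

Lemma block_permE i : block_perm i = block_next i.
Proof. exact: permE. Qed.

Lemma blk_block_perm k i : blk ((block_perm ^+ k)%g i) = blk i.
Proof.
elim: k => [|k IH]; first by rewrite expg0 perm1.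
by rewrite expgSr permM block_permE blk_next.
Qed.

Lemma off_block_perm k i : off ((block_perm ^+ k)%g i) = ((off i + k) %% len i)%N.
Proof.
elim: k => [|k IH]; first by rewrite expg0 perm1 addn0 modn_small ?off_lt.
rewrite expgSr permM block_permE off_next IH /len blk_block_perm.
by rewrite -addn1 modnDml addn1 addnS.
Qed.

Definition block_set r : {set 'I_m} := [set i : 'I_m | blk i == r]%SET.

Lemma porbit_block_perm i : porbit block_perm i = block_set (blk i).
Proof.
apply/setP => j; rewrite inE; apply/porbitP/eqP => [[k ->]|e].
  by rewrite blk_block_perm.
exists (off j + (len i - off i))%N; apply: block_eq; first by rewrite blk_block_perm.
rewrite off_block_perm addnCA subnKC ?(ltnW (off_lt _)) // modnDr modn_small //.
by rewrite /len -e off_lt.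
Qed.

Lemma card_block_set r : (r < size eta)%N -> #|block_set r| = nth 0%N eta r.
Proof.
move=> rs; pose f (c : 'I_(nth 0%N eta r)) : 'I_m := Ordinal (flatten_indexP (ltn_ord c)).
have f_inj : injective f.
  move=> c d /(congr1 val) /= e; apply/val_inj => /=.
  by rewrite -(flatten_indexKr (ltn_ord c)) e flatten_indexKr.
have -> : block_set r = [set f c | c : 'I_(nth 0%N eta r)]%SET.
  apply/setP => i; rewrite inE; apply/eqP/imsetP => [e|[c _ ->]]; last first.
    exact: flatten_indexKl (ltn_ord c).
  have lt : (off i < nth 0%N eta r)%N by rewrite -e off_lt.
  exists (Ordinal lt) => //; apply/val_inj.
  by rewrite /= -e reshape_indexK.
by rewrite card_imset // card_ord.
Qed.

Lemma block_permP : has_cycle_type eta block_perm.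
Proof.
rewrite /has_cycle_type.
have ne r : (r < size eta)%N -> exists i : 'I_m, blk i = r.
  move=> rs; have lt : (0 < nth 0%N eta r)%N by apply: (allP eta_gt0); rewrite mem_nth.
  by exists (Ordinal (flatten_indexP lt)); apply: flatten_indexKl.
have pe : perm_eq (enum (porbits block_perm)) [seq block_set r | r <- iota 0 (size eta)].
  apply: uniq_perm; first exact: enum_uniq.
    rewrite map_inj_in_uniq ?iota_uniq // => r r'; rewrite !mem_iota /= add0n => rs _ e.
    have [i ei] := ne r rs.
    have : i \in block_set r' by rewrite -e inE ei.
    by rewrite inE ei => /eqP.
  move=> C; rewrite mem_enum; apply/imsetP/mapP => [[i _ ->]|[r]].
    exists (blk i); last exact: porbit_block_perm.
    by rewrite mem_iota add0n /=; apply: reshape_indexP (ltn_ord i).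
  rewrite mem_iota add0n /= => /ne[i <-] ->; exists i => //.
  by rewrite porbit_block_perm.
apply: perm_trans (perm_map _ pe) _; rewrite -map_comp.
rewrite (eq_in_map _ (nth 0%N eta) _).1 ?map_nth_iota0 ?take_size // => r.
by rewrite mem_iota add0n /= => /card_block_set.
Qed.

End CycleType.

Theorem chi_frob lam N eta : is_part lam -> (size lam <= N)%N ->
  all (leq 1) eta -> sumn eta = sumn lam ->
  chi lam eta = frob eta (beta_row N (nth 0%N lam)).
Proof.
move=> lam_part leN eta0 sz; rewrite /chi; case: pickP => [s hs|none].
  have leM := leqnn (nth 0%N lam 0).
  have [k k0 young2] := young_mx_sqr lam_part leN leM.
  by rewrite (specht_char_frob k0 young2); apply: frob_perm_eq.
(* The default value of [chi] does not occur: [block_perm] has the required cycle type. *)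
have [s hs] : exists s : 'S_(sumn lam), has_cycle_type eta s.
  by rewrite -sz; exists (block_perm eta); apply: block_permP.
by rewrite none in hs.
Qed.

(** * Adding dominoes to bead configurations *)

Lemma nth_filter_pos s i : sorted geq s -> nth 0%N (filter (leq 1) s) i = nth 0%N s i.
Proof.
elim: s i => [|a s IH] i //= a_s; have ss := path_sorted a_s.
have /allP/= le_a := order_path_min (rev_trans leq_trans) a_s.
case: a a_s le_a => [|a] a_s le_a /=; last by case: i => //= i; apply: IH.
rewrite IH //; have z j : nth 0%N s j = 0%N.
  have [lt|ge] := ltnP j (size s); last by rewrite nth_default.
  by have := le_a _ (mem_nth 0%N lt); rewrite leqn0 => /eqP.
by case: i => [|i]; rewrite /= !z.
Qed.

Section MkPart.
Variables (n : nat) (f : nat -> nat).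
Hypothesis f_mono : forall i, (i.+1 < n)%N -> (f i.+1 <= f i)%N.

Definition mk_part : seq nat := filter (leq 1) (mkseq f n).

Lemma mkseq_sorted : sorted geq (mkseq f n).
Proof.
apply/(sortedP 0%N) => i; rewrite size_mkseq => lt.
by rewrite !nth_mkseq ?(ltnW lt) //; apply: f_mono.
Qed.

Lemma mk_part_is_part : is_part mk_part.
Proof.
apply/andP; split; last by rewrite mem_filter.
by apply: sorted_filter mkseq_sorted => a b c /= ba ac; apply: leq_trans ac ba.
Qed.

Lemma nth_mk_part i : nth 0%N mk_part i = if (i < n)%N then f i else 0%N.
Proof.
rewrite /mk_part nth_filter_pos ?mkseq_sorted //; case: ltnP => h; first by rewrite nth_mkseq.
by rewrite nth_default ?size_mkseq.
Qed.

Lemma size_mk_part : (size mk_part <= n)%N.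
Proof. by rewrite size_filter -[X in (_ <= X)%N](size_mkseq f n) count_size. Qed.

End MkPart.

Lemma nth_part_gt0 mu i : is_part mu -> (0 < nth 0 mu i)%N = (i < size mu)%N.
Proof.
case/andP => _ n0; have [lt|ge] := ltnP i (size mu); last by rewrite nth_default.
by rewrite lt0n; apply: contraNneq n0 => <-; apply: mem_nth.
Qed.

Lemma part_eq mu1 mu2 : is_part mu1 -> is_part mu2 ->
  (forall i, nth 0%N mu1 i = nth 0%N mu2 i) -> mu1 = mu2.
Proof.
move=> p1 p2 e; have es : size mu1 = size mu2.
  apply/eqP; rewrite eqn_leq; apply/andP; split; rewrite leqNgt.
    by rewrite -nth_part_gt0 // e nth_default.
  by rewrite -nth_part_gt0 // -e nth_default.
by apply: (eq_from_nth (x0 := 0%N)).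
Qed.

Lemma is_part_gt0 mu : is_part mu -> all (leq 1) mu.
Proof.
by case/andP => _ n0; apply/allP => i imu; rewrite lt0n; apply: contraNneq n0 => <-.
Qed.

Lemma size_le_sumn mu : all (leq 1) mu -> (size mu <= sumn mu)%N.
Proof. by elim: mu => //= k mu IH /andP[k0 /IH]; lia. Qed.

Lemma nth_le_sumn mu i : (nth 0 mu i <= sumn mu)%N.
Proof. by elim: mu i => [|k mu IH] [|i] //=; [lia | have := IH i; lia]. Qed.

Lemma sum_nth_sumn N mu : (size mu <= N)%N -> (\sum_(i < N) nth 0 mu i = sumn mu)%N.
Proof.
move=> leN; rewrite sumnE [RHS](big_nth 0%N) [RHS]big_mkord [RHS](big_ord_widen _ (nth 0%N mu) leN).
rewrite [RHS]big_mkcond /=; apply: eq_bigr => i _.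
by case: ltnP => // ?; rewrite nth_default.
Qed.

(** A partition of m has at most m parts, each at most m, so all of them arise from finite functions
    after removal of zeros. *)
Definition partitions (m : nat) : seq (seq nat) :=
  [seq mu <- undup [seq filter (leq 1) [seq val k | k <- codom f] |
     f : {ffun 'I_m -> 'I_m.+1}] | is_part mu & sumn mu == m].

Lemma mem_partitions m mu : (mu \in partitions m) = is_part mu && (sumn mu == m).
Proof.
rewrite mem_filter andbC mem_undup; apply/andb_idl => /andP[mu_part /eqP smu].
apply/mapP; exists [ffun i : 'I_m => inord (nth 0%N mu i)]; first by rewrite mem_enum.
have -> : [seq val k | k <- codom [ffun i : 'I_m => (inord (nth 0%N mu i) : 'I_m.+1)]] =
  mkseq (nth 0%N mu) m.
  rewrite codomE -map_comp /mkseq -val_enum_ord -map_comp; apply: eq_map => i /=.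
  by rewrite ffunE inordK // ltnS (leq_trans (nth_le_sumn _ _)) // smu.
rewrite -[RHS]/(mk_part m (nth 0%N mu)); apply: part_eq => //.
  by apply: mk_part_is_part => i _; apply: nth_part_mono.
move=> i; rewrite nth_mk_part; last by move=> j _; apply: nth_part_mono.
case: ltnP => // le; rewrite nth_default //.
by rewrite (leq_trans _ le) // -smu size_le_sumn // is_part_gt0.
Qed.

Lemma partitions_uniq m : uniq (partitions m).
Proof. by rewrite filter_uniq // undup_uniq. Qed.

Lemma beta_row_lt N mu (i j : 'I_N) : is_part mu -> (i < j)%N ->
  beta_row N (nth 0%N mu) 0 j < beta_row N (nth 0%N mu) 0 i.
Proof.
by move=> p lt; rewrite !mxE ltz_nat; have := nth_part_mono p (ltnW lt); have := ltn_ord j; lia.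
Qed.

Lemma beta_row_inj N mu1 mu2 : is_part mu1 -> is_part mu2 ->
  (size mu1 <= N)%N -> (size mu2 <= N)%N ->
  beta_row N (nth 0%N mu1) = beta_row N (nth 0%N mu2) -> mu1 = mu2.
Proof.
move=> p1 p2 s1 s2 /rowP e; apply: part_eq => // i.
have [lt|ge] := ltnP i N; last by rewrite !nth_default // (leq_trans _ ge).
by have := e (Ordinal lt); rewrite !mxE /=; lia.
Qed.

Lemma sum_beta_row N mu : (size mu <= N)%N ->
  \sum_i beta_row N (nth 0%N mu) 0 i = \sum_i staircase N 0 i + (sumn mu)%:Z.
Proof.
move=> leN; rewrite -(sum_nth_sumn leN) -natz natr_sum addrC -big_split /=.
by apply: eq_bigr => i _; rewrite !mxE natz PoszD.
Qed.

Lemma decreasing_beta N (f : nat -> nat) :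
  (forall i, (i.+1 < N)%N -> (f i.+1 < f i)%N) ->
  exists mu, [/\ is_part mu, (size mu <= N)%N &
    forall i, (i < N)%N -> (nth 0 mu i + (N - i.+1))%N = f i].
Proof.
move=> gap.
have low i : (i < N)%N -> (N - i.+1 <= f i)%N.
  move=> lt; move: {2}(N - i.+1)%N (leqnn (N - i.+1)) => k.
  elim: k i lt => [|k IH] i lt; first by rewrite leqn0 => /eqP ->.
  move=> le; have [//|gt] := posnP (N - i.+1)%N; first by move=> ->.
  have lt' : (i.+1 < N)%N by lia.
  have := IH i.+1 lt'; have := gap i lt'; lia.
pose g i := (f i - (N - i.+1))%N.
have g_mono i : (i.+1 < N)%N -> (g i.+1 <= g i)%N.
  by move=> lt; rewrite /g; have := gap i lt; have := low _ lt; have := low _ (ltnW lt); lia.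
exists (mk_part N g); split; [exact: mk_part_is_part | exact: size_mk_part |].
by move=> i lt; rewrite nth_mk_part // lt /g subnK ?low.
Qed.

Lemma beta_row_sort N (x : 'rV[int]_N) : (forall i, 0 <= x 0 i) -> injective (x 0) ->
  exists mu (w : 'S_N), [/\ is_part mu, (size mu <= N)%N &
    x = col_perm w (beta_row N (nth 0%N mu))].
Proof.
move=> x0 x_inj; pose t := [tuple absz (x 0 i) | i < N].
have t_uniq : uniq t.
  rewrite map_inj_uniq ?enum_uniq // => i j e; apply: x_inj.
  by have := x0 i; have := x0 j; lia.
pose s := sort geq t.
have s_sort : sorted gtn s.
  by rewrite gtn_sorted_uniq_geq sort_uniq t_uniq sort_sorted.
have /tuple_permP[w es] : perm_eq s t by rewrite perm_sort.
have ss : size s = N by rewrite size_sort size_tuple.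
have gap i : (i.+1 < N)%N -> (nth 0%N s i.+1 < nth 0%N s i)%N.
  by rewrite -ss => lt; apply: (sortedP 0%N s_sort).
have [mu [p sz h]] := decreasing_beta gap.
exists mu, (w^-1)%g; split=> //.
have nth_s (k : 'I_N) : nth 0%N s k = absz (x 0 (w k)).
  by rewrite es -tnth_nth !tnth_mktuple.
apply/rowP => i; rewrite !mxE h // nth_s permKV.
by have := x0 i; lia.
Qed.

(** The reciprocal factorial of u/2, extended by 0 to odd and negative u; with these zeros
    [half_fact_inv_sub2] holds for every integer. *)
Definition half_fact_inv (u : int) : algC :=
  if u is Posz k then (if odd k then 0 else ((k./2)`!)%:R^-1) else 0.

Lemma half_fact_inv_neq0 u : half_fact_inv u != 0 -> (0 <= u) /\ ~~ odd `|u|.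
Proof. by case: u => [k|k] /=; case: odd; rewrite ?eqxx. Qed.

Lemma half_fact_inv_double k : half_fact_inv (k.*2)%:Z = (k`!)%:R^-1.
Proof. by rewrite /= odd_double doubleK. Qed.

Lemma half_fact_inv_sub2 u : half_fact_inv (u - 2) = u%:~R / 2 * half_fact_inv u.
Proof.
case: u => [[|[|k]]|k].
- by rewrite /= mul0r mul0r.
- by rewrite /= mulr0.
- have -> : (k.+2)%:Z - 2 = k%:Z by lia.
  rewrite /= negbK; case: ifP => [_|/negbT ok]; first by rewrite mulr0.
  have -> : (Posz k.+2)%:~R = 2 * (k./2).+1%:R :> algC.
    by rewrite -pmulrn -natrM; congr (_%:R); have := odd_double_half k; rewrite (negbTE ok); lia.
  rewrite factS natrM [2 * _]mulrC mulfK ?pnatr_eq0 // invfM mulrA mulfV ?mul1r //.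
  by rewrite pnatr_eq0.
by rewrite /= mulr0.
Qed.

Definition domino_det N (x y : 'rV[int]_N) : algC :=
  \det (\matrix_(i < N, j < N) half_fact_inv (x 0 i - y 0 j)).

Lemma sum_sub_unitv N (x : 'rV[int]_N) i k :
  \sum_j (x - unitv i *+ k) 0 j = \sum_j x 0 j - k%:Z.
Proof.
have -> : k%:Z = \sum_j (unitv i *+ k) 0 j.
  rewrite (bigD1 i) //= big1 => [|j /negbTE ji].
    by rewrite addr0 mulmxnE unitvE eqxx -[LHS]natz.
  by rewrite mulmxnE unitvE ji mul0rn.
by rewrite -sumrB; apply: eq_bigr => j _; rewrite !mxE.
Qed.

Section DominoDet.
Variable N : nat.
Implicit Types x y : 'rV[int]_N.

(** Lowering x_i by 2 multiplies the Leibniz term of w by (x_i - y_(w i)) / 2, and the sum of these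
    factors over i does not depend on w. *)
Lemma domino_det_step x y k : \sum_i (x 0 i - y 0 i) = (k.+1.*2)%:Z ->
  \sum_i domino_det (x - unitv i *+ 2) y = k.+1%:R * domino_det x y.
Proof.
move=> exy; rewrite exchange_big mulr_sumr; apply: eq_bigr => w _ /=.
rewrite -mulr_sumr mulrCA; congr (_ * _).
transitivity (\sum_i (x 0 i - y 0 (w i))%:~R / 2 *
    \prod_r half_fact_inv (x 0 r - y 0 (w r))).
  apply: eq_bigr => i _; rewrite (bigD1 i) //= [in RHS](bigD1 i) //= mulrA; congr (_ * _).
    by rewrite !mxE !eqxx -half_fact_inv_sub2; congr half_fact_inv; rewrite /=; ring.
  apply: eq_bigr => r /negbTE ri; rewrite !mxE eqxx ri /=.
  by congr half_fact_inv; ring.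
rewrite -mulr_suml -mulr_suml -(rmorph_sum (intr : int -> algC)) /=.
rewrite sumrB [X in _ - X](_ : _ = \sum_i y 0 i); last first.
  by rewrite [RHS](reindex_inj (@perm_inj _ w)).
rewrite -sumrB exy -muln2 PoszM intrM mulfK ?pnatr_eq0 //.
by congr (_ * _); apply: eq_bigr => r _; rewrite mxE.
Qed.

Lemma domino_det_neq0 x y : domino_det x y != 0 ->
  exists w : 'S_N, forall i, half_fact_inv (x 0 i - y 0 (w i)) != 0.
Proof.
have [/existsP[w /forallP h]|nw] :=
  boolP [exists w : 'S_N, forall i, half_fact_inv (x 0 i - y 0 (w i)) != 0].
  by exists w.
case/eqP; rewrite /domino_det /determinant big1 // => w _.
move: nw; rewrite negb_exists => /forallP/(_ w); rewrite negb_forall => /existsP[i].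
by rewrite negbK => /eqP h; rewrite (bigD1 i) //= mxE h mul0r mulr0.
Qed.

Lemma domino_det_col_perm w x y :
  domino_det (col_perm w x) y = (-1) ^+ w * domino_det x y.
Proof.
rewrite /domino_det -[(-1) ^+ w in RHS]det_perm -det_mulmx -row_permE.
by congr (\det _); apply/matrixP => i j; rewrite !mxE.
Qed.

(** If the inequality failed at i, then [w] would inject the indices from i on into those strictly
    beyond i. *)
Lemma sorted_domination x y (w : 'S_N) :
  (forall i j : 'I_N, (i <= j)%N -> x 0 j <= x 0 i) ->
  (forall i j : 'I_N, (i <= j)%N -> y 0 j <= y 0 i) ->
  (forall i, y 0 (w i) <= x 0 i) -> forall i, y 0 i <= x 0 i.
Proof.
move=> xs ys xy i.
suff [k /andP[ik wk]] : exists k : 'I_N, (i <= k)%N && (w k <= i)%N.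
  by apply: le_trans (ys _ _ wk) (le_trans (xy _) (xs _ _ ik)).
apply/existsP; apply: contraT; rewrite negb_exists => /forallP h.
have : (#|[pred k : 'I_N | (i <= k)%N]| <= #|[pred k : 'I_N | (i < k)%N]|)%N.
  rewrite -[X in (X <= _)%N](card_image (@perm_inj _ w)); apply: subset_leq_card; apply/fintype.subsetP => l /fintype.imageP[k ik ->].
  by have := h k; rewrite inE in ik; rewrite ik inE /= -ltnNge.
rewrite leqNgt => /negP[]; apply/proper_card/properP; split.
  by apply/fintype.subsetP => k; rewrite !inE; apply: ltnW.
by exists i; rewrite !inE ?leqnn ?ltnn.
Qed.

End DominoDet.

Lemma beta_row_le N mu (i j : 'I_N) : is_part mu -> (i <= j)%N ->
  beta_row N (nth 0%N mu) 0 j <= beta_row N (nth 0%N mu) 0 i.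
Proof.
rewrite leq_eqVlt => p /orP[/eqP/val_inj -> //|lt].
exact: ltW (beta_row_lt p lt).
Qed.

(** For equal partitions the matrix is unitriangular. A nonzero determinant forces entrywise
    domination, and equal sums turn it into equality. *)
Lemma domino_det_diag N mu1 mu2 : is_part mu1 -> is_part mu2 ->
  (size mu1 <= N)%N -> (size mu2 <= N)%N -> sumn mu1 = sumn mu2 ->
  domino_det (beta_row N (nth 0%N mu1)) (beta_row N (nth 0%N mu2)) = (mu1 == mu2)%:R.
Proof.
move=> p1 p2 s1 s2 es; case: eqP => [<-|ne].
  rewrite /domino_det -det_tr det_trig.
    rewrite big1 // => i _; rewrite !mxE subrr.
    by rewrite /= fact0 invr1.
  apply/is_trig_mxP => i j lt; rewrite mxE mxE; apply/eqP/contraT => /half_fact_inv_neq0[].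
  by have := beta_row_lt p1 lt; lia.
apply/eqP/contraT => /domino_det_neq0[w hw]; case: ne.
apply: (beta_row_inj p1 p2 s1 s2); apply/rowP.
have le i := @sorted_domination N _ _ w (fun i j => beta_row_le p1) (fun i j => beta_row_le p2)
  (fun i => _) i.
have {}le i : beta_row N (nth 0%N mu2) 0 i <= beta_row N (nth 0%N mu1) 0 i.
  apply: le => j; by have [] := half_fact_inv_neq0 (hw j); rewrite subr_ge0.
have : \sum_i (beta_row N (nth 0%N mu1) 0 i - beta_row N (nth 0%N mu2) 0 i) = 0.
  by rewrite sumrB !sum_beta_row // es subrr.
move/eqP; rewrite psumr_eq0 => [/allP h i|i _]; last by rewrite subr_ge0.
by have := h i (mem_index_enum _); rewrite subr_eq0 => /eqP.
Qed.

(** Both sides obey the same recursion in k. For k = 0 both alternate in [x], which may thus be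
    sorted into some mu0 + delta, and [domino_det_diag] keeps only the term mu0. *)
Theorem frob_domino N k nu (x : 'rV[int]_N) : (sumn nu <= N)%N ->
  \sum_i x 0 i = \sum_i staircase N 0 i + (sumn nu)%:Z + (k.*2)%:Z ->
  frob (nseq k 2 ++ nu) x = (k`!)%:R * \sum_(mu <- partitions (sumn nu))
    frob nu (beta_row N (nth 0%N mu)) * domino_det x (beta_row N (nth 0%N mu)).
Proof.
move=> leN; have sizeN mu : mu \in partitions (sumn nu) ->
    [/\ is_part mu, (size mu <= N)%N & sumn mu = sumn nu].
  rewrite mem_partitions => /andP[p /eqP e]; split=> //.
  by rewrite (leq_trans _ leN) // -e size_le_sumn ?is_part_gt0.
elim: k x => [|k IH] x; last first.
  move=> ex; rewrite -[nseq k.+1 2 ++ nu]/(2%N :: (nseq k 2 ++ nu)) frob_recl.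
  under eq_bigr => i _.
    rewrite IH; last by rewrite sum_sub_unitv ex; lia.
    over.
  rewrite -mulr_sumr exchange_big factS mulnC natrM -mulrA; congr (_ * _).
  rewrite mulr_sumr [LHS]big_seq [RHS]big_seq; apply: eq_bigr => mu mu_in /=.
  have [p s e] := sizeN mu mu_in.
  rewrite -mulr_sumr (@domino_det_step _ _ _ k) 1?mulrCA //.
  by rewrite sumrB ex sum_beta_row // e; lia.
rewrite double0 addr0 fact0 mul1r cat0s => ex.
have [x_inj|] := injectiveP (x 0); last first.
  move/injectiveP/injectivePn => [i [j ij xij]]; rewrite (frob_repeated _ ij xij).
  rewrite big1 // => mu _; rewrite /domino_det (determinant_alternate ij) ?mulr0 // => l.
  by rewrite !mxE xij.
have [/forallP x0|] := boolP [forall i, 0 <= x 0 i]; last first.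
  rewrite negb_forall => /existsP[i]; rewrite -ltNge => xi.
  rewrite (frob_neg _ xi) big1 // => mu _.
  rewrite /domino_det (expand_det_row _ i) big1 ?mulr0 // => j _.
  rewrite mxE (_ : half_fact_inv _ = 0) ?mul0r //.
  by apply/eqP/contraT => /half_fact_inv_neq0[]; rewrite [beta_row _ _ _ _]mxE; lia.
have [mu0 [w [p0 s0 ew]]] := beta_row_sort x0 x_inj.
have e0 : sumn mu0 = sumn nu.
  have : \sum_i beta_row N (nth 0%N mu0) 0 i = \sum_i x 0 i.
    by rewrite ew (reindex_inj (@perm_inj _ w)); apply: eq_bigr => i _; rewrite !mxE.
  by rewrite sum_beta_row // ex; lia.
rewrite ew frob_col_perm; under eq_bigr do rewrite domino_det_col_perm mulrCA.
rewrite -mulr_sumr; congr (_ * _).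
have mu0_in : mu0 \in partitions (sumn nu) by rewrite mem_partitions p0 e0 eqxx.
rewrite (bigD1_seq mu0) ?partitions_uniq //=.
rewrite domino_det_diag // eqxx mulr1 big1_seq ?addr0 // => mu /andP[ne /sizeN[p s e]].
by rewrite domino_det_diag // ?e0 // eq_sym (negbTE ne) mulr0.
Qed.

(** * Balanced partitions and bead parities *)

Lemma balanced_is_part mu : balanced mu -> is_part mu.
Proof. by case. Qed.

Lemma ltn_ext a b : (forall j, (j < b)%N = (j < a)%N) -> b = a.
Proof. by move=> h; have := h a; have := h b; rewrite !ltnn; lia. Qed.

Lemma ltn_ext_add1 a b c : (c < a)%N = false ->
  (forall j, (j < b)%N = (j < a)%N || (j == c)) -> a = c /\ b = a.+1.
Proof.
move=> ca h; have hc := h c; have ha := h a; have hc1 := h c.+1.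
move: hc ha hc1; rewrite !ltnn eqxx orbT /= (gtn_eqF (ltnSn c)).
by case: eqP => ?; lia.
Qed.

Lemma ltn_ext_add2 a b c : (c < a)%N = false ->
  (forall j, (j < b)%N = (j < a)%N || ((j == c) || (j == c.+1))) -> b = a.+2.
Proof.
move=> ca h; have hc := h c; have ha := h a; have hc1 := h c.+1; have hc2 := h c.+2.
move: hc ha hc1 hc2; rewrite !ltnn !eqxx !orbT /=.
rewrite (gtn_eqF (ltnSn c.+1)) (gtn_eqF (leqW (ltnSn c))).
by case: (a =P c) => ?; case: (a =P c.+1) => ?; lia.
Qed.

Lemma adds_dominoP mu lam : adds_domino mu lam ->
  (exists r, forall i, nth 0 lam i = nth 0 mu i + (i == r).*2)%N \/
  (exists r, nth 0 mu r = nth 0 mu r.+1 /\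
     forall i, nth 0 lam i = nth 0 mu i + ((i == r) || (i == r.+1)))%N.
Proof.
case=> -[r c] [_ [[]/= -> nc nd h]]; [left; exists r => i|right; exists r].
  have H j : (j < nth 0 lam i)%N =
    (j < nth 0 mu i)%N || (i == r) && ((j == c) || (j == c.+1)).
    by have := h (i, j); rewrite /in_diagram /= !xpair_eqE -andb_orr.
  move/negbTE: nc; rewrite /in_diagram /=.
  have [er|ir] := eqVneq i r => nc; last first.
    by rewrite addn0; apply: ltn_ext => j; rewrite H (negbTE ir) orbF.
  rewrite addn2; apply: (@ltn_ext_add2 _ _ c); first by rewrite er.
  by move=> j; rewrite H er eqxx.
have H i j : (j < nth 0 lam i)%N =
    (j < nth 0 mu i)%N || (((i == r) || (i == r.+1)) && (j == c)).
  by have := h (i, j); rewrite /in_diagram /= !xpair_eqE -andb_orl.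
move/negbTE: nc; move/negbTE: nd; rewrite /in_diagram /= => nd nc.
have [e1 f1] : nth 0%N mu r = c /\ nth 0%N lam r = (nth 0%N mu r).+1.
  by apply: ltn_ext_add1 => // j; rewrite H eqxx.
have [e2 f2] : nth 0%N mu r.+1 = c /\ nth 0%N lam r.+1 = (nth 0%N mu r.+1).+1.
  by apply: ltn_ext_add1 => // j; rewrite H eqxx orbT.
split=> [|i]; first by rewrite e1 e2.
have [->|ir] := eqVneq i r; first by rewrite f1 addn1.
have [->|ir1] := eqVneq i r.+1; first by rewrite f2 addn1.
by rewrite addn0; apply: ltn_ext => j; rewrite H (negbTE ir) (negbTE ir1) /= orbF.
Qed.

Lemma nth_size_le mu N : is_part mu -> (forall i, (N <= i)%N -> nth 0%N mu i = 0%N) ->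
  (size mu <= N)%N.
Proof. by move=> p h; rewrite leqNgt -nth_part_gt0 // h. Qed.

Lemma nth_le_size mu lam N : is_part mu -> (forall i, nth 0 mu i <= nth 0 lam i)%N ->
  (size lam <= N)%N -> (size mu <= N)%N.
Proof.
move=> p le sN; apply: nth_size_le => // i Ni; apply/eqP; rewrite -leqn0.
by rewrite (leq_trans (le i)) // nth_default // (leq_trans sN).
Qed.

Lemma adds_domino_le mu lam : adds_domino mu lam -> (forall i, nth 0 mu i <= nth 0 lam i)%N.
Proof. by case/adds_dominoP => [[r h]|[r [_ h]]] i; rewrite h leq_addr. Qed.

(** The number of beads is taken even, so that a balanced partition has [n] beads of each parity. *)
Definition bead n (mu : seq nat) (i : nat) : nat := (nth 0 mu i + (n + n - i.+1))%N.

(** [s] lists the even beads before the odd ones, keeping the decreasing order of beads within each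
    class. *)
Definition parity_sort n (mu : seq nat) (s : 'S_(n + n)) : Prop :=
  [/\ forall k : 'I_n, ~~ odd (bead n mu (s (lshift n k))),
      forall k : 'I_n, odd (bead n mu (s (rshift n k))),
      forall k l : 'I_n, (k < l)%N -> (s (lshift n k) < s (lshift n l))%N &
      forall k l : 'I_n, (k < l)%N -> (s (rshift n k) < s (rshift n l))%N].

Section Sort0.
Variable n : nat.

Definition sort0_pos (p : 'I_(n + n)) : nat :=
  match split p with inl k => k.*2.+1 | inr k => k.*2 end.

Lemma sort0_subproof p : (sort0_pos p < n + n)%N.
Proof. by rewrite /sort0_pos addnn; case: split => k; have := ltn_ord k; lia. Qed.

Lemma sort0_inj : injective (fun p => Ordinal (sort0_subproof p)).
Proof.
move=> p q /(congr1 val) /=; rewrite /sort0_pos.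
case: split_ordP => k ->; case: split_ordP => l -> e.
- by congr lshift; apply/val_inj => /=; lia.
- by lia.
- by lia.
by congr rshift; apply/val_inj => /=; lia.
Qed.

Definition sort0 : 'S_(n + n) := perm sort0_inj.

Lemma sort0_l k : sort0 (lshift n k) = k.*2.+1 :> nat.
Proof. by rewrite permE /= /sort0_pos (unsplitK (inl _ k)). Qed.

Lemma sort0_r k : sort0 (rshift n k) = k.*2 :> nat.
Proof. by rewrite permE /= /sort0_pos (unsplitK (inr _ k)). Qed.

Lemma parity_sort0 : parity_sort [::] sort0.
Proof.
split=> k *; rewrite /bead ?nth_nil ?sort0_l ?sort0_r //; have := ltn_ord k; lia.
Qed.

End Sort0.

Lemma count_odd_sum N mu : (size mu <= N)%N ->
  count odd mu = (\sum_(i < N) odd (nth 0 mu i))%N.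
Proof.
move=> leN; rewrite -sum1_count big_mkcond /= (big_nth 0%N) big_mkord.
rewrite (big_ord_widen _ (fun i => if odd (nth 0%N mu i) then 1%N else 0%N) leN).
rewrite big_mkcond /=; apply: eq_bigr => i _.
by case: ltnP => [|?]; [case: odd | rewrite nth_default].
Qed.

Lemma sigma_horizontal mu lam r :
  (forall i, nth 0 lam i = nth 0 mu i + (i == r).*2)%N -> sigma lam = sigma mu.
Proof.
move=> h; pose N := maxn (size mu) (size lam).
rewrite /sigma !(@count_odd_sum N) ?leq_maxl ?leq_maxr //.
congr (_ ^+ _./2); apply: eq_bigr => i _.
by rewrite h oddD odd_double addbF.
Qed.

(** Two equal parts change parity together, so the number of odd parts changes by 2. *)
Lemma sigma_vertical mu lam r : is_part lam -> nth 0%N mu r = nth 0%N mu r.+1 ->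
  (forall i, nth 0 lam i = nth 0 mu i + ((i == r) || (i == r.+1)))%N ->
  sigma lam = - sigma mu.
Proof.
move=> p e h; pose N := maxn (size mu) (size lam).
have r1 : (r.+1 < N)%N.
  by rewrite leq_max -(nth_part_gt0 _ p) h eqxx orbT addn1 orbT.
rewrite /sigma !(@count_odd_sum N) ?leq_maxl ?leq_maxr //.
pose i0 := Ordinal (ltnW r1); pose i1 := Ordinal r1.
have i10 : i1 != i0 by rewrite -val_eqE /= (gtn_eqF (ltnSn r)).
rewrite (bigD1 i0) //= (bigD1 i1) //= [in RHS](bigD1 i0) //= [in RHS](bigD1 i1) //=.
rewrite !h !eqxx orbT !addn1 /= -e.
rewrite [X in (_ + (_ + X))%N](eq_bigr (fun i : 'I_N => (odd (nth 0%N mu i) : nat))); last first.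
  move=> i /andP[ne0 ne1]; rewrite h.
  by rewrite -!val_eqE /= in ne0 ne1; rewrite (negbTE ne0) (negbTE ne1) addn0.
set S := (\sum_(i < N | _) _)%N.
case: odd => /=; rewrite ?addnA ?add0n ?addSn ?add0n /= exprS; ring.
Qed.

(** A horizontal domino moves one bead by 2 and keeps all parities. A vertical one exchanges the
    parities of two adjacent beads, so the sorting permutation gains an adjacent transposition
    exactly when [sigma] changes sign. *)
Lemma balanced_parity_sort n mu : balanced mu -> (size mu <= n + n)%N ->
  exists2 s : 'S_(n + n), parity_sort mu s & (-1) ^+ s = sigma mu * (-1) ^+ sort0 n.
Proof.
elim=> {mu} [_|mu lam bmu IH p dom szl].
  by exists (sort0 n); [apply: parity_sort0 | rewrite /sigma /= mul1r].
have pmu := balanced_is_part bmu.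
have [s [sl sr ml mr] es] := IH (nth_le_size pmu (adds_domino_le dom) szl).
case: (adds_dominoP dom) => [[r h]|[r [e h]]].
  have od i : odd (bead n lam i) = odd (bead n mu i).
    by rewrite /bead h addnAC oddD odd_double addbF.
  exists s; last by rewrite (sigma_horizontal h).
  by split=> // k; rewrite od.
have r1 : (r.+1 < n + n)%N.
  by apply: leq_trans szl; rewrite -nth_part_gt0 // h eqxx orbT addn1.
pose i0 := Ordinal (ltnW r1); pose i1 := Ordinal r1.
have i01 : i0 != i1 by rewrite -val_eqE /= (ltn_eqF (ltnSn r)).
have ob0 : odd (bead n mu r) = ~~ odd (bead n mu r.+1).
  by rewrite /bead e -oddS; congr odd; have := r1; lia.
have od (i : 'I_(n + n)) : odd (bead n lam (tperm i0 i1 i)) = odd (bead n mu i).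
  case: tpermP => [->|->|/eqP n0 /eqP n1] /=.
  - by rewrite /bead h eqxx orbT -/(bead _ _ _) addnAC addn1 /= -/(bead n mu r.+1) ob0.
  - by rewrite /bead h eqxx addnAC addn1 /= -/(bead n mu r) ob0 negbK.
  - by rewrite -!val_eqE /= in n0 n1; rewrite /bead h (negbTE n0) (negbTE n1) addn0.
(* An adjacent transposition reverses only the pair [i0], [i1], whose beads lie in different parity
   classes. *)
have mono (i j : 'I_(n + n)) : odd (bead n mu i) = odd (bead n mu j) -> (i < j)%N ->
    (tperm i0 i1 i < tperm i0 i1 j)%N.
  have v (k : 'I_(n + n)) : tperm i0 i1 k =
      (if k == r :> nat then r.+1 else if k == r.+1 :> nat then r else k) :> nat.
    case: tpermP => [->|->|/eqP n0 /eqP n1] /=; rewrite ?eqxx //.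
      by rewrite (gtn_eqF (ltnSn r)).
    by rewrite -!val_eqE /= in n0 n1; rewrite (negbTE n0) (negbTE n1).
  move=> oe lt; have ne : ~ (i = r :> nat /\ j = r.+1 :> nat).
    by case=> ei ej; move: oe; rewrite ei ej ob0; case: odd.
  by rewrite !v; do !case: eqP => //= ?; lia.
exists (s * tperm i0 i1)%g; last first.
  by rewrite odd_permM odd_tperm i01 addbT signrN es (sigma_vertical p e h) mulNr.
split=> [k|k|k l kl|k l kl]; rewrite !permM ?od //.
  by apply: mono; [rewrite (negbTE (sl k)) (negbTE (sl l)) | apply: ml].
by apply: mono; [rewrite sr sr | apply: mr].
Qed.

(** As many beads of each parity as for the empty partition, that is, an empty 2-core. *)
Definition parity_balanced n (mu : seq nat) : Prop :=
  exists w : 'S_(n + n), forall j : 'I_(n + n), odd (bead n mu j) = odd (bead n [::] (w j)).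

Lemma parity_sort_balanced n mu (s : 'S_(n + n)) : parity_sort mu s -> parity_balanced n mu.
Proof.
case=> sl sr _ _; have [tl tr _ _] := parity_sort0 n.
exists (s^-1 * sort0 n)%g => j; rewrite permM -{1}[j](permKV s).
case: (split_ordP ((s^-1)%g j)) => k ->.
  by rewrite (negbTE (sl k)) (negbTE (tl k)).
by rewrite sr tr.
Qed.

Lemma bead0_half_inj n (i j : 'I_(n + n)) : odd (bead n [::] i) = odd (bead n [::] j) ->
  i./2 = j./2 -> i = j.
Proof.
rewrite /bead !nth_nil !add0n => e1 e2; apply/val_inj => /=.
have := ltn_ord i; have := ltn_ord j; move: e1 e2; lia.
Qed.

(** A bead at 2n or above would bring with it, by steps of 2, more than n beads of its parity. *)
Lemma parity_balanced_closed n mu : is_part mu -> parity_balanced n mu ->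
  (forall i : 'I_(n + n), (2 <= bead n mu i)%N ->
     exists j : 'I_(n + n), bead n mu j = (bead n mu i - 2)%N) ->
  forall i : 'I_(n + n), (bead n mu i < n + n)%N.
Proof.
move=> p [w hw] cl i.
have down t : (t <= (bead n mu i)./2)%N ->
    exists j : 'I_(n + n), bead n mu j = (bead n mu i - t.*2)%N.
  elim: t => [_|t IH lt]; first by exists i; rewrite subn0.
  have [j ej] := IH (ltnW lt).
  have [|j' ej'] := cl j; first by rewrite ej; lia.
  by exists j'; rewrite ej' ej; lia.
have H (t : 'I_(bead n mu i)./2.+1) : exists j : 'I_(n + n), bead n mu j == (bead n mu i - t.*2)%N.
  by have [|j ej] := down t; [rewrite -ltnS | exists j; rewrite ej].
pose f t := xchoose (H t).
have fE t : bead n mu (f t) = (bead n mu i - t.*2)%N by apply/eqP/(xchooseP (H t)).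
have half_lt (j : 'I_(n + n)) : (j./2 < n)%N by have := ltn_ord j; lia.
have g_inj : injective (fun t => Ordinal (half_lt (w (f t)))).
  move=> t t' /(congr1 val) /= e.
  have : w (f t) = w (f t').
    apply: bead0_half_inj e; rewrite -!hw !fE !oddB ?odd_double //.
      by have := ltn_ord t'; lia.
    by have := ltn_ord t; lia.
  move/perm_inj/(congr1 (fun j : 'I__ => bead n mu j)); rewrite !fE => e'.
  by apply/val_inj => /=; have := ltn_ord t; have := ltn_ord t'; lia.
by have := leq_card _ g_inj; rewrite !card_ord; lia.
Qed.

Lemma adds_horizontal mu lam r :
  (forall i, nth 0 lam i = nth 0 mu i + (i == r).*2)%N -> adds_domino mu lam.
Proof.
move=> h; exists (r, nth 0%N mu r), (r, (nth 0%N mu r).+1).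
rewrite /in_diagram /= !ltnn -ltnNge ltnS leqnSn; split=> //; first by left.
by case=> i j; rewrite /= !xpair_eqE h; case: eqP => [->|_] /=; lia.
Qed.

Lemma adds_vertical mu lam r : nth 0%N mu r = nth 0%N mu r.+1 ->
  (forall i, nth 0 lam i = nth 0 mu i + ((i == r) || (i == r.+1)))%N ->
  adds_domino mu lam.
Proof.
move=> e h; exists (r, nth 0%N mu r), (r.+1, nth 0%N mu r).
rewrite /in_diagram; split; [by right | by rewrite /= ltnn | by rewrite /= e ltnn |].
case=> i j; rewrite /= !xpair_eqE h.
by case: (i =P r) => [->|_]; case: (_ =P r.+1) => [?|_] /=; try subst i; rewrite -?e; lia.
Qed.

Lemma bead_lt n mu (i j : 'I_(n + n)) : is_part mu -> (i < j)%N ->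
  (bead n mu j < bead n mu i)%N.
Proof. by move=> p lt; have := beta_row_lt p lt; rewrite !mxE ltz_nat. Qed.

(** Induction on the size: moving a bead down by 2 into a free position removes a domino and keeps
    the parity count. *)
Lemma parity_balanced_is_balanced n mu : is_part mu -> (size mu <= n + n)%N ->
  parity_balanced n mu -> balanced mu.
Proof.
move: {2}(sumn mu) (leqnn (sumn mu)) => b.
elim: b mu => [|b IH] mu leb p sz pb.
  suff -> : mu = [::] by apply: balanced_nil.
  by apply/eqP; rewrite -size_eq0 -leqn0 (leq_trans (size_le_sumn (is_part_gt0 p))).
have [->|mu0] := eqVneq mu [::]; first exact: balanced_nil.
have s0 : (0 < size mu)%N by case: (mu) mu0.
(* If no bead could move, [parity_balanced_closed] would put the first bead below 2n, although the
   first part is positive. *)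
have [i [b2 nex]] : exists i : 'I_(n + n), (2 <= bead n mu i)%N /\
    forall j : 'I_(n + n), bead n mu j <> (bead n mu i - 2)%N.
  apply/not_existsP => h.
  have K0 : (0 < n + n)%N by apply: leq_trans sz.
  have := parity_balanced_closed p pb _ (Ordinal K0); rewrite /bead /=.
  have : (0 < nth 0 mu 0)%N by rewrite nth_part_gt0.
  suff cl (j : 'I_(n + n)) : (2 <= bead n mu j)%N ->
     exists j' : 'I_(n + n), bead n mu j' = (bead n mu j - 2)%N.
    by move=> lt /(_ cl); lia.
  move=> b2; have := h j => /not_andP[//|/existsNP[j' /contrapT ej']].
  by exists j'.
have nth_out j : (n + n <= j)%N -> nth 0%N mu j = 0%N.
  by move=> le; rewrite nth_default // (leq_trans sz).
have step nu : is_part nu -> (forall j, nth 0 nu j <= nth 0 mu j)%N ->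
    (nth 0 nu i < nth 0 mu i)%N -> parity_balanced n nu -> adds_domino nu mu -> balanced mu.
  move=> pn le lt pbn dom; have sn := nth_le_size pn le sz.
  apply: (balanced_domino _ p dom); apply: IH => //.
  rewrite -ltnS (leq_trans _ leb) // -(sum_nth_sumn sn) -(sum_nth_sumn sz).
  rewrite (bigD1 i) //= [X in (_ < X)%N](bigD1 i) //=.
  by rewrite -addSn leq_add //; apply: leq_sum => j _; apply: le.
have mono := @nth_part_mono mu _ _ p.
have ltiK := ltn_ord i.
(* An occupied intermediate position is the next row, of equal length, and the domino removed is
   vertical; otherwise it is horizontal. *)
have [/existsP[j /eqP ej]|] := boolP [exists j : 'I_(n + n), bead n mu j == (bead n mu i).-1].
  have ij : j = i.+1 :> nat.
    apply/eqP; rewrite eqn_leq andbC; apply/andP; split; rewrite leqNgt; apply/negP => lt.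
      have [ji|ji] := ltnP j i; first by have := bead_lt p ji; lia.
      have {}ji : i = j by apply/val_inj/eqP; rewrite eqn_leq ji -ltnS.
      by move: ej b2; rewrite -ji; lia.
    have lti : (i.+1 < n + n)%N by apply: ltn_trans lt (ltn_ord j).
    have := @bead_lt n mu i (Ordinal lti) p (ltnSn i).
    by have := @bead_lt n mu (Ordinal lti) j p lt; lia.
  have ltjK := ltn_ord j.
  have e : nth 0%N mu i = nth 0%N mu i.+1 by move: ej b2; rewrite /bead ij in ltjK *; lia.
  have F : (nth 0 mu i.+2 + 1 <= nth 0 mu i.+1)%N.
    have [lt2|ge2] := ltnP i.+2 (n + n).
      have := @bead_lt n mu j (Ordinal lt2) p; rewrite ij /= => /(_ (ltnSn _)).
      by have := nex (Ordinal lt2); move: ej b2; rewrite /bead ij /=; lia.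
    by rewrite nth_out //; move: ej b2; rewrite /bead ij; lia.
  pose g k := (nth 0 mu k - ((k == i) || (k == i.+1)))%N.
  have g_mono k : (k.+1 < n + n)%N -> (g k.+1 <= g k)%N.
    move=> _; rewrite /g; have := mono k k.+1 (leqnSn k).
    case: (k =P i) => [->|_]; first by do !case: eqP => /= *; lia.
    by case: (k =P i.+1) => [->|_]; do !case: eqP => /= *; lia.
  have nuE k : nth 0%N (mk_part (n + n) g) k = g k.
    rewrite nth_mk_part //; case: ltnP => // le.
    by rewrite /g nth_out.
  have muE k : nth 0%N mu k = (g k + ((k == i) || (k == i.+1)))%N.
    by rewrite /g; case: (k =P i) => [->|_] /=; [|case: (k =P i.+1) => [->|_] /=]; lia.
  apply: (step (mk_part (n + n) g)).
  - exact: mk_part_is_part.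
  - by move=> k; rewrite nuE leq_subr.
  - by rewrite nuE /g eqxx /=; lia.
  - have [w hw] := pb; exists (tperm i j * w)%g => k; rewrite permM -hw /bead nuE.
    case: tpermP => [->|->|/eqP ki /eqP kj] /=.
    + by rewrite /g eqxx ij -e /=; congr odd; lia.
    + by rewrite /g ij eqxx orbT -e; move: F e; lia.
    by rewrite /g -!val_eqE /= ij in ki kj *; rewrite (negbTE ki) (negbTE kj) subn0.
  apply: (@adds_vertical _ _ i) => [|k]; last by rewrite nuE muE.
  by rewrite !nuE /g !eqxx orbT e; case: (_ == _).
rewrite negb_exists => /forallP nex1.
have F : (nth 0 mu i.+1 + 2 <= nth 0 mu i)%N.
  have [lt1|ge1] := ltnP i.+1 (n + n).
    have := @bead_lt n mu i (Ordinal lt1) p (ltnSn _).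
    by have /eqP := nex1 (Ordinal lt1); have := nex (Ordinal lt1); move: b2; rewrite /bead /=; lia.
  by rewrite nth_out //; move: b2; rewrite /bead; lia.
pose g k := (nth 0 mu k - (k == i).*2)%N.
have g_mono k : (k.+1 < n + n)%N -> (g k.+1 <= g k)%N.
  move=> _; rewrite /g; have := mono k k.+1 (leqnSn k).
  by case: (k =P i) => [->|_]; do !case: eqP => /= *; lia.
have nuE k : nth 0%N (mk_part (n + n) g) k = g k.
  rewrite nth_mk_part //; case: ltnP => // le.
  by rewrite /g nth_out.
have muE k : nth 0%N mu k = (g k + (k == i).*2)%N.
  by rewrite /g; case: (k =P i) => [->|_] /=; lia.
apply: (step (mk_part (n + n) g)).
- exact: mk_part_is_part.
- by move=> k; rewrite nuE leq_subr.
- by rewrite nuE /g eqxx /=; lia.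
- have [w hw] := pb; exists w => k; rewrite -hw /bead nuE.
  by rewrite [in RHS]muE [in RHS]addnAC [in RHS]oddD odd_double addbF.
by apply: (@adds_horizontal _ _ i) => k; rewrite nuE muE.
Qed.

(** * Two-quotients *)

(** The element of [maya] given by row i, less one half: an integer, with a parity. *)
Definition charge (mu : seq nat) (i : nat) : int := (nth 0%N mu i)%:Z - (i.+1)%:Z.

Lemma charge_lt mu i j : is_part mu -> (i < j)%N -> charge mu j < charge mu i.
Proof. by move=> p lt; rewrite /charge; have := nth_part_mono p (ltnW lt); lia. Qed.

Lemma maya_charge mu x : maya mu x <-> exists i, x = (charge mu i)%:~R + 2^-1.
Proof. by split=> -[i ->]; exists i; rewrite /charge rmorphB /=. Qed.

Lemma intr_double (z : int) : (z *+ 2)%:~R = 2 * z%:~R :> rat.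
Proof. by rewrite mulr2n intrD; ring. Qed.

Lemma charge_half_inj (z z' : int) : (z%:~R + 2^-1 : rat) = z'%:~R + 2^-1 -> z = z'.
Proof. by move/addIr/intr_inj. Qed.

(** Charges strictly decrease along the rows, so the set determines them one after another. *)
Lemma maya_inj mu1 mu2 : is_part mu1 -> is_part mu2 -> maya mu1 = maya mu2 -> mu1 = mu2.
Proof.
move=> p1 p2 e.
have sub a b : is_part a -> is_part b -> maya a = maya b ->
    forall i, exists k, charge a i = charge b k.
  move=> pa pb eab i; have : maya b ((charge a i)%:~R + 2^-1).
    by rewrite -eab; apply/maya_charge; exists i.
  by case/maya_charge => k /charge_half_inj; exists k.
have le a b : is_part a -> is_part b -> maya a = maya b -> forall i,
    (forall j, (j < i)%N -> charge a j = charge b j) -> charge a i <= charge b i.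
  move=> pa pb eab i IH; have [k ek] := sub a b pa pb eab i.
  have [lt|gt|eki] := ltngtP k i; last by rewrite ek eki.
    by have := charge_lt pa lt; rewrite ek (IH _ lt) ltxx.
  by rewrite ek ltW // charge_lt.
apply: part_eq => // i; suff : charge mu1 i = charge mu2 i by rewrite /charge; lia.
elim/ltn_ind: i => i IH; apply/eqP; rewrite eq_le !le //.
by move=> j /IH.
Qed.

Section Quotient.
Variables (n : nat) (mu : seq nat) (s : 'S_(n + n)).
Hypotheses (mu_part : is_part mu) (mu_size : (size mu <= n + n)%N).
Hypothesis s_sort : parity_sort mu s.

Lemma charge_bead (i : 'I_(n + n)) : charge mu i = (bead n mu i)%:Z - (n + n)%:Z.
Proof. by rewrite /charge /bead; have := ltn_ord i; lia. Qed.

Lemma charge_out mu' N i : (size mu' <= N)%N -> (N <= i)%N -> charge mu' i = - (i.+1)%:Z.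
Proof. by move=> sz le; rewrite /charge nth_default ?(leq_trans sz) // sub0r. Qed.

Lemma half_beads_decreasing (h : 'I_n -> 'I_(n + n)) (b : bool) :
  (forall k, odd (bead n mu (h k)) = b) ->
  (forall k l : 'I_n, (k < l)%N -> (h k < h l)%N) ->
  exists al, [/\ is_part al, (size al <= n)%N &
    forall k : 'I_n, (bead n mu (h k) = (nth 0 al k + (n - k.+1)).*2 + b)%N].
Proof.
move=> hb hm; pose f k := if insub k is Some k' then (bead n mu (h k'))./2 else 0%N.
have fE (k : 'I_n) : f k = (bead n mu (h k))./2 by rewrite /f valK.
have bE k : (bead n mu (h k) = (f (val k)).*2 + b)%N.
  by rewrite fE -[LHS]odd_double_half hb addnC.
have [|al [p sz e]] := @decreasing_beta n f.
  move=> i lt; have := bead_lt mu_part (hm (Ordinal (ltnW lt)) (Ordinal lt) (ltnSn i)).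
  by rewrite !bE /=; lia.
by exists al; split=> // k; rewrite bE e.
Qed.

(** A charge is a bead minus 2n, so the two classes of [maya] elements are the even and the odd
    beads. Halved, each class is a set of [n] beads of one quotient partition. *)
Lemma two_quotient_beads : exists al be, two_quotient mu = (al, be) /\
  [/\ is_part al, is_part be, (size al <= n)%N & (size be <= n)%N] /\
  (forall k : 'I_n, bead n mu (s (lshift n k)) = (nth 0 al k + (n - k.+1)).*2)%N /\
  (forall k : 'I_n, bead n mu (s (rshift n k)) = (nth 0 be k + (n - k.+1)).*2.+1)%N.
Proof.
have [sl sr ml mr] := s_sort.
have [|al [pa sa ea]] := @half_beads_decreasing (fun k => s (lshift n k)) false _ ml.
  by move=> k; apply/negbTE.
have [be [pb sb eb]] := @half_beads_decreasing (fun k => s (rshift n k)) true sr mr.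
exists al, be; split; last first.
  by split=> //; split=> k; rewrite ?ea ?eb ?addn0 ?addn1.
have chg (i : 'I_(n + n)) : (exists2 k : 'I_n, i = s (lshift n k) & charge mu i = charge al k *+ 2) \/
    (exists2 k : 'I_n, i = s (rshift n k) & charge mu i = charge be k *+ 2 + 1).
  rewrite -(permKV s i); case: (split_ordP ((s^-1)%g i)) => k ->; [left|right]; exists k => //.
    by rewrite charge_bead ea /charge; have := ltn_ord k; lia.
  by rewrite charge_bead eb /charge; have := ltn_ord k; lia.
have al_ex j : exists i, charge mu i = charge al j *+ 2.
  have [lt|ge] := ltnP j n.
    exists (s (lshift n (Ordinal lt))).
    by rewrite charge_bead ea /charge /=; lia.
  (* Beyond the beads row i has charge -(i+1), so row j of [al] corresponds to row 2j+1 of [mu]; row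
     j of [be] will correspond to row 2j. *)
  exists (j.*2.+1); rewrite (charge_out sa ge) (charge_out mu_size); last by lia.
  by lia.
have be_ex j : exists i, charge mu i = charge be j *+ 2 + 1.
  have [lt|ge] := ltnP j n.
    exists (s (rshift n (Ordinal lt))).
    by rewrite charge_bead eb /charge /=; lia.
  exists (j.*2); rewrite (charge_out sb ge) (charge_out mu_size); last by lia.
  by lia.
have mu_ex i : (exists j, charge mu i = charge al j *+ 2) \/
    (exists j, charge mu i = charge be j *+ 2 + 1).
  have [lt|ge] := ltnP i (n + n).
    by case: (chg (Ordinal lt)) => [[k _ e]|[k _ e]]; [left|right]; exists k.
  rewrite (charge_out mu_size ge) -[i]odd_double_half; case: (odd i); [left|right];
    exists i./2; [rewrite (charge_out sa)|rewrite (charge_out sb)]; lia.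
suff q : is_two_quotient mu (al, be).
  rewrite /two_quotient; apply: xget_unique => // -[a b] [/= qa qb ma mb].
  by case: q => /= _ _ ha hb; congr pair; apply: maya_inj; rewrite ?ma ?mb.
split=> //=; apply/predeqP => y; split.
- case/maya_charge => j ->; have [i ei] := al_ex j.
    exists ((charge mu i)%:~R + 2^-1).
      split; first by apply/maya_charge; exists i.
      by exists (charge al j); rewrite ei intr_double.
    by rewrite ei intr_double /=; field.
- case=> _ [/maya_charge[i ->] [k ek]] <-; apply/maya_charge.
    have {}ek : charge mu i = k *+ 2.
      by apply: charge_half_inj; rewrite ek intr_double.
    case: (mu_ex i) => -[j ej]; last by move: ek ej; lia.
    by exists j; rewrite ej intr_double /=; field.
- case/maya_charge => j ->; have [i ei] := be_ex j.
    exists ((charge mu i)%:~R + 2^-1).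
      split; first by apply/maya_charge; exists i.
      by exists (charge be j + 1); rewrite ei intrD [in LHS]intrD intr_double; field.
    by rewrite ei intrD intr_double; field.
  case=> _ [/maya_charge[i ->] [k ek]] <-; apply/maya_charge.
  have {}ek : charge mu i = k *+ 2 - 1.
    by apply: charge_half_inj; rewrite ek intrB intr_double; field.
  case: (mu_ex i) => -[j ej]; first by move: ek ej; lia.
  by exists j; rewrite ej intrD intr_double; field.
Qed.

End Quotient.

(** * Shifted Schur functions *)

Lemma falling_ffact X Y : falling (X%:R : algC) Y = (X ^_ Y)%:R.
Proof.
elim: Y => [|Y IH]; first by rewrite /falling big_ord0.
rewrite /falling big_ord_recr /= -/(falling _ Y) IH ffactnSr natrM.
have [le|lt] := leqP Y X; first by rewrite natrB.
by rewrite ffact_small // !mul0r.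
Qed.

(** The numerator of the shifted Schur function at [al], and its denominator when [mu] is empty. *)
Definition ffact_det n (mu al : seq nat) : algC :=
  \det (\matrix_(i < n, j < n)
    ((nth 0%N al i + (n - i.+1)) ^_ (nth 0%N mu j + (n - j.+1)))%:R).

Lemma shifted_schur_ffact n mu al :
  shifted_schur mu (fun i : 'I_n => (nth 0%N al i)%:R) =
  ffact_det n mu al / ffact_det n [::] al.
Proof.
rewrite /shifted_schur /ffact_det; congr (_ / _); congr (\det _); apply/matrixP => i j;
  by rewrite !mxE -natrD falling_ffact ?nth_nil.
Qed.

(** In the last row, falling factorials of 0, only the last entry is nonzero; every other row
    releases its leading factor. The product does not involve [mu] and cancels in the quotient. *)
Lemma ffact_detS n mu al : (size al <= n)%N -> (size mu <= n)%N ->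
  ffact_det n.+1 mu al = (\prod_(i < n) (nth 0%N al i + (n - i))%:R) * ffact_det n mu al.
Proof.
move=> sa sm; rewrite /ffact_det (expand_det_row _ ord_max) (bigD1 ord_max) //=.
rewrite big1 ?addr0 => [|j jn]; last first.
  have lt : (j < n)%N by rewrite ltn_neqAle -ltnS ltn_ord andbT; apply: contra_neq jn => /= e; apply/val_inj.
  rewrite mxE /= nth_default // subnn ffact_small ?mul0r //.
  by rewrite addn0; lia.
rewrite mxE /= nth_default // subnn nth_default // ffact0n eqxx mul1r.
rewrite /cofactor addnn -signr_odd odd_double mul1r.
pose D := diag_mx (\row_(i < n) (nth 0%N al i + (n - i))%:R : 'rV[algC]_n).
have -> : \prod_(i < n) (nth 0%N al i + (n - i))%:R = \det D.
  by rewrite det_diag; apply: eq_bigr => i _; rewrite mxE.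
rewrite -det_mulmx; congr (\det _); apply/matrixP => i j.
have bumpE (k : 'I_n) : bump n k = k by rewrite /bump leqNgt ltn_ord.
rewrite mul_diag_mx !mxE /= !bumpE.
have e k (f : nat -> nat) : (k < n)%N -> (f k + (n.+1 - k.+1) = (f k + (n - k.+1)).+1)%N by lia.
by rewrite (e i (nth 0%N al)) // (e j (nth 0%N mu)) // ffactSS natrM -addnS subnSK.
Qed.

Lemma shifted_schur_part_stable n mu al : (size al <= n)%N -> (size mu <= n)%N ->
  shifted_schur_part mu al = ffact_det n mu al / ffact_det n [::] al.
Proof.
move=> sa sm; rewrite /shifted_schur_part shifted_schur_ffact.
have : (maxn (size mu) (size al) <= n)%N by rewrite geq_max sm sa.
elim: n {sa sm} => [|n IH]; first by rewrite leqn0 => /eqP ->.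
rewrite leq_eqVlt => /orP[/eqP -> //|]; rewrite ltnS => le; rewrite IH //.
move: le; rewrite geq_max => /andP[sm sa].
rewrite !ffact_detS // -mulf_div divff ?mul1r //.
by apply/prodf_neq0 => i _; rewrite pnatr_eq0 -lt0n; have := ltn_ord i; lia.
Qed.

Lemma half_fact_inv_subD X Y :
  half_fact_inv ((X.*2)%:Z - (Y.*2)%:Z) = (X`!)%:R^-1 * (X ^_ Y)%:R.
Proof.
have [le|lt] := leqP Y X; last first.
  rewrite ffact_small // mulr0; apply/eqP/contraT => /half_fact_inv_neq0[].
  by lia.
have -> : (X.*2)%:Z - (Y.*2)%:Z = ((X - Y).*2)%:Z by lia.
rewrite half_fact_inv_double -(ffact_fact le) natrM invfM mulrAC mulVf ?mul1r //.
by rewrite pnatr_eq0 -lt0n ffact_gt0.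
Qed.

Section Factor.
Variables (n : nat) (lam mu al be a b : seq nat) (sl sm : 'S_(n + n)).

Hypothesis al_beads :
  forall k : 'I_n, (bead n lam (sl (lshift n k)) = (nth 0%N al k + (n - k.+1)).*2)%N.
Hypothesis be_beads :
  forall k : 'I_n, (bead n lam (sl (rshift n k)) = (nth 0%N be k + (n - k.+1)).*2.+1)%N.
Hypothesis a_beads :
  forall k : 'I_n, (bead n mu (sm (lshift n k)) = (nth 0%N a k + (n - k.+1)).*2)%N.
Hypothesis b_beads :
  forall k : 'I_n, (bead n mu (sm (rshift n k)) = (nth 0%N b k + (n - k.+1)).*2.+1)%N.

Definition fact_weight (g : seq nat) : algC :=
  \prod_(k < n) ((nth 0%N g k + (n - k.+1))`!)%:R^-1.

(** Entries between beads of different parity vanish, so parity sorting makes the matrix block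
    diagonal. By 1/(X-Y)! = (X falling Y)/X! each block is a diagonal matrix times the matrix of
    [ffact_det]. *)
Lemma domino_det_factor :
  domino_det (beta_row (n + n) (nth 0%N lam)) (beta_row (n + n) (nth 0%N mu)) =
  (-1) ^+ sl * (-1) ^+ sm * (fact_weight al * ffact_det n a al)
                          * (fact_weight be * ffact_det n b be).
Proof.
pose A : 'M[algC]_(n + n) := \matrix_(i, j) half_fact_inv ((bead n lam i)%:Z - (bead n mu j)%:Z).
have -> : domino_det (beta_row (n + n) (nth 0%N lam)) (beta_row (n + n) (nth 0%N mu)) = \det A.
  by congr (\det _); apply/matrixP => i j; rewrite !mxE.
pose B := row_perm sl (col_perm sm A).
have dB : \det B = (-1) ^+ sl * (-1) ^+ sm * \det A.
  by rewrite /B row_permE col_permE !det_mulmx !det_perm odd_permV -mulrA [\det A * _]mulrC.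
have -> : \det A = (-1) ^+ sl * (-1) ^+ sm * \det B.
  by rewrite dB mulrA mulrACA -!expr2 !sqrr_sign !mul1r.
rewrite -!mulrA; congr (_ * (_ * _)).
have W g (f : 'I_n -> 'I_n -> algC) :
    \det (\matrix_(i, j) (((nth 0%N g i + (n - i.+1))`!)%:R^-1 * f i j)) =
    fact_weight g * \det (\matrix_(i, j) f i j).
  pose D := diag_mx (\row_(i < n) ((nth 0%N g i + (n - i.+1))`!)%:R^-1 : 'rV[algC]_n).
  have -> : fact_weight g = \det D by rewrite det_diag; apply: eq_bigr => i _; rewrite mxE.
  by rewrite -det_mulmx; congr (\det _); apply/matrixP => i j; rewrite mul_diag_mx !mxE.
rewrite mulrA /ffact_det -(W al) -(W be) -[B]submxK.
have -> : ursubmx B = 0.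
  apply/matrixP => i j; rewrite !mxE al_beads b_beads.
  by apply/eqP/contraT => /half_fact_inv_neq0[]; lia.
have -> : dlsubmx B = 0.
  apply/matrixP => i j; rewrite !mxE be_beads a_beads.
  by apply/eqP/contraT => /half_fact_inv_neq0[]; lia.
rewrite det_ublock; congr (_ * _); congr (\det _); apply/matrixP => i j; rewrite !mxE.
  by rewrite al_beads a_beads half_fact_inv_subD.
by rewrite be_beads b_beads -half_fact_inv_subD; congr half_fact_inv; lia.
Qed.

End Factor.

(** * The character ratio *)

Lemma balanced_sumn_even mu : balanced mu -> ~~ odd (sumn mu).
Proof.
elim=> // {}mu lam bmu IH p dom; pose N := maxn (size mu) (size lam).
have smu : (size mu <= N)%N by rewrite leq_maxl.
have slam : (size lam <= N)%N by rewrite leq_maxr.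
have E (e : nat -> bool) : (forall i, odd (nth 0 lam i) = odd (nth 0 mu i) (+) e i) ->
    odd (sumn lam) = odd (sumn mu) (+) odd (\sum_(i < N) e i).
  move=> h; rewrite -!(sum_nth_sumn (N := N)) //.
  rewrite -oddD -big_split /=; elim/big_rec2: _ => // i x y _.
  by rewrite !oddD h => ->; rewrite oddb.
case: (adds_dominoP dom) => [[r h]|[r [e h]]].
  rewrite (E (fun=> false)); first by rewrite big1 // addbF.
  by move=> i; rewrite h oddD odd_double.
have r1 : (r.+1 < N)%N by rewrite (leq_trans _ slam) // -nth_part_gt0 // h eqxx orbT addn1.
rewrite (E (fun i => (i == r) || (i == r.+1))); last by move=> i; rewrite h oddD oddb.
rewrite (bigD1 (Ordinal (ltnW r1))) //= (bigD1 (Ordinal r1)) //=; last first.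
  by rewrite -val_eqE /= (gtn_eqF (ltnSn r)).
rewrite eqxx eqxx orbT big1 ?addbF // => i; rewrite -!val_eqE /= => /andP[/negbTE -> /negbTE ->].
by [].
Qed.

Lemma diagram_sub_nth mu lam : diagram_sub mu lam <-> forall i, (nth 0 mu i <= nth 0 lam i)%N.
Proof.
split=> h; last by case=> i j; rewrite /in_diagram /=; have := h i; lia.
move=> i; rewrite leqNgt; apply/negP => lt.
by have := h (i, nth 0%N lam i); rewrite /in_diagram /= ltnn => /(_ lt).
Qed.

Lemma diagram_sub_sumn mu lam : diagram_sub mu lam -> (sumn mu <= sumn lam)%N.
Proof.
move=> /diagram_sub_nth h; pose N := maxn (size mu) (size lam).
rewrite -!(sum_nth_sumn (N := N)) ?leq_maxl ?leq_maxr //.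
by apply: leq_sum => i _; apply: h.
Qed.

(** A nonzero Leibniz term matches each bead of [lam] with a bead of [mu] of the same parity and not
    above it. Parities make [mu] balanced; domination gives the inclusion of diagrams. *)
Lemma domino_det_neq0_balanced n lam mu (s : 'S_(n + n)) :
  is_part lam -> parity_sort lam s -> is_part mu -> (size mu <= n + n)%N ->
  domino_det (beta_row (n + n) (nth 0%N lam)) (beta_row (n + n) (nth 0%N mu)) != 0 ->
  balanced mu /\ diagram_sub mu lam.
Proof.
move=> plam slam pmu szmu /domino_det_neq0[w hw].
have {}hw i : (bead n mu (w i) <= bead n lam i)%N /\ odd (bead n lam i) = odd (bead n mu (w i)).
  have [] := half_fact_inv_neq0 (hw i); rewrite !mxE -/(bead n lam i) -/(bead n mu (w i)).
  by lia.
split.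
  apply: (@parity_balanced_is_balanced n) => //.
  have [w1 hw1] := parity_sort_balanced slam.
  exists (w^-1 * w1)%g => j; rewrite permM -hw1 -{1}[j](permKV w).
  by case: (hw ((w^-1)%g j)).
apply/diagram_sub_nth => i; have [lt|ge] := ltnP i (n + n); last first.
  by rewrite nth_default // (leq_trans szmu).
have := @sorted_domination _ (beta_row (n + n) (nth 0%N lam)) (beta_row (n + n) (nth 0%N mu)) w
  (fun i j => beta_row_le plam) (fun i j => beta_row_le pmu) _ (Ordinal lt).
rewrite !mxE /= => h; suff : (nth 0%N mu i + (n + n - i.+1) <= nth 0%N lam i + (n + n - i.+1))%N.
  by rewrite leq_add2r.
rewrite -lez_nat; apply: h => j; rewrite !mxE lez_nat.
by case: (hw j).
Qed.

Lemma frob_dominoes n lam : is_part lam -> (size lam <= n + n)%N -> ~~ odd (sumn lam) ->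
  frob (nseq (sumn lam)./2 2%N) (beta_row (n + n) (nth 0%N lam)) =
  ((sumn lam)./2`!)%:R *
    domino_det (beta_row (n + n) (nth 0%N lam)) (beta_row (n + n) (nth 0%N [::])).
Proof.
move=> p sz ev; rewrite -[nseq _ _]cats0 frob_domino //=; last first.
  by rewrite sum_beta_row // even_halfK // addr0.
have in0 : [::] \in partitions 0 by rewrite mem_partitions.
rewrite (bigD1_seq [::]) ?partitions_uniq //= big1_seq ?addr0 => [|mu]; last first.
  rewrite mem_partitions => /and3P[ne pmu /eqP s0].
  by have := size_le_sumn (is_part_gt0 pmu); rewrite s0 leqn0 size_eq0 (negbTE ne).
congr (_ * _); rewrite -[X in X * _]/(frob [::] _).
have -> : beta_row (n + n) (nth 0%N [::]) = staircase (n + n).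
  by apply/rowP => i; rewrite !mxE nth_nil.
by rewrite frob0_staircase mul1r.
Qed.

(* [A0] and [B0] may vanish here, as inversion is multiplicative even at 0. *)
Lemma cancel_common_factors (F : fieldType) (u v wa wb s f A B A0 B0 : F) :
  u != 0 -> v != 0 -> wa != 0 -> wb != 0 ->
  f * (u * (s * v) * (wa * A) * (wb * B)) / (u * v * (wa * A0) * (wb * B0)) =
  s * f * (A / A0) * (B / B0).
Proof.
move=> u0 v0 wa0 wb0; pose c := u * v * wa * wb.
have c0 : c != 0 by rewrite !mulf_neq0.
have -> : f * (u * (s * v) * (wa * A) * (wb * B)) = s * f * (c * (A * B)).
  by rewrite /c; ring.
have -> : u * v * (wa * A0) * (wb * B0) = c * (A0 * B0) by rewrite /c; ring.
rewrite -[LHS]mulrA.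
by rewrite -mulf_div divff // mul1r -mulf_div !mulrA.
Qed.

Theorem mainTheorem2 (lam nu alpha beta : seq nat)
    (lam_balanced : balanced lam) (nu_balanced : balanced nu)
    (nu_sub_lam : diagram_sub nu lam)
    (lam_quotient : two_quotient lam = (alpha, beta)) :
  chi lam (nu ++ nseq (sumn lam - sumn nu)./2 2%N)
    / chi lam (nseq (sumn lam)./2 2%N)
  = (((sumn lam - sumn nu)./2)`!)%:R / (((sumn lam)./2)`!)%:R
    * \sum_(mu \in [set mu : seq nat | [/\ balanced mu, sumn mu = sumn nu
                                       & diagram_sub mu lam]]%classic)
        sigma mu * chi mu nu
        * shifted_schur_part (two_quotient mu).1 alpha
        * shifted_schur_part (two_quotient mu).2 beta.
Proof.
(* The size of [lam] bounds the number of parts of [lam] and of every [mu] in the sum. *)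
pose n := sumn lam; pose N := (n + n)%N; pose k := ((sumn lam - sumn nu)./2)%N.
have plam := balanced_is_part lam_balanced.
have pnu := balanced_is_part nu_balanced.
have nu_le : (sumn nu <= n)%N := diagram_sub_sumn nu_sub_lam.
have size_part mu : is_part mu -> (sumn mu <= n)%N -> (size mu <= N)%N.
  by move=> p le; have := size_le_sumn (is_part_gt0 p); rewrite /N; lia.
have szlam := size_part lam plam (leqnn _).
have lam_even := balanced_sumn_even lam_balanced.
have nu_even := balanced_sumn_even nu_balanced.
have kE : (k.*2 = sumn lam - sumn nu)%N by rewrite even_halfK // oddB // (negbTE lam_even) (negbTE nu_even).
pose x := beta_row N (nth 0%N lam).
pose D mu := domino_det x (beta_row N (nth 0%N mu)).
have chi_lam : chi lam (nu ++ nseq k 2) = (k`!)%:R *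
    \sum_(mu <- partitions (sumn nu)) frob nu (beta_row N (nth 0%N mu)) * D mu.
  have gt0 : all (leq 1) (nu ++ nseq k 2) by rewrite all_cat is_part_gt0 // all_nseq orbT.
  have sz : sumn (nu ++ nseq k 2) = sumn lam.
    by rewrite sumn_cat sumn_nseq mul2n kE subnKC.
  have pe : perm_eq (nu ++ nseq k 2) (nseq k 2 ++ nu) by rewrite perm_catC.
  have le_N : (sumn nu <= N)%N by apply: leq_trans nu_le (leq_addr _ _).
  have sum_x : \sum_i x 0 i = \sum_i staircase N 0 i + (sumn nu)%:Z + (k.*2)%:Z.
    by rewrite sum_beta_row // kE; lia.
  rewrite (chi_frob plam szlam gt0 sz).
  rewrite (frob_perm_eq _ pe).
  exact: frob_domino le_N sum_x.
have chi_lam0 : chi lam (nseq (sumn lam)./2 2) = ((sumn lam)./2`!)%:R * D [::].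
  rewrite (@chi_frob _ N) ?frob_dominoes ?all_nseq ?orbT //.
  by rewrite sumn_nseq mul2n even_halfK.
rewrite chi_lam chi_lam0 -mulf_div -/k; congr (_ * _).
have [sl sort_lam _] := balanced_parity_sort lam_balanced szlam.
have [al [be [eab [[pa pb sa sb] [al_beads be_beads]]]]] := two_quotient_beads plam szlam sort_lam.
move: eab; rewrite lam_quotient => -[ea eb]; subst al be.
have [s0l s0r _ _] := parity_sort0 n.
rewrite mulr_suml; set S := [set mu | _]%classic.
pose T mu : algC := frob nu (beta_row N (nth 0%N mu)) * D mu / D [::].
transitivity (\sum_(mu \in [set` partitions (sumn nu)]%classic) T mu).
  by rewrite -fsbig_seq // partitions_uniq.
transitivity (\sum_(mu \in S) T mu).
  (* Partitions of |nu| outside [S] have a vanishing determinant. *)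
  apply/esym/fsbig_widen => [mu [bmu emu _]|mu [/= mu_in nS]].
    by rewrite /= mem_partitions balanced_is_part // emu eqxx.
  move: mu_in; rewrite mem_partitions => /andP[pmu /eqP emu].
  rewrite /T; have [->|D0] := eqVneq (D mu) 0; first by rewrite mulr0 mul0r.
  have szmu : (size mu <= N)%N by rewrite size_part // emu.
  by have [bmu submu] := domino_det_neq0_balanced plam sort_lam pmu szmu D0; case: nS.
apply: eq_fsbigr => mu /set_mem[bmu emu _].
have pmu := balanced_is_part bmu.
have szmu : (size mu <= N)%N by rewrite size_part // emu.
have [sm sort_mu sgn_mu] := balanced_parity_sort bmu szmu.
have [a [b [eab [[qa qb ra rb] [a_beads b_beads]]]]] := two_quotient_beads pmu szmu sort_mu.
rewrite eab /= !(@shifted_schur_part_stable n) // /T.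
have -> : chi mu nu = frob nu (beta_row N (nth 0%N mu)).
  by rewrite (@chi_frob _ N) ?is_part_gt0.
have -> := domino_det_factor al_beads be_beads a_beads b_beads : D mu = _.
(* The empty partition has an empty 2-quotient: [D [::]] supplies the denominators of both shifted
   Schur functions, and the sign of [sort0] is the one relating [sm] to [sigma mu]. *)
have nil_l (j : 'I_n) : bead n [::] (sort0 n (lshift n j)) = (nth 0 [::] j + (n - j.+1)).*2.
  by rewrite /bead !nth_nil sort0_l; lia.
have nil_r (j : 'I_n) : bead n [::] (sort0 n (rshift n j)) = (nth 0 [::] j + (n - j.+1)).*2.+1.
  by rewrite /bead !nth_nil sort0_r; have := ltn_ord j; lia.
have -> := domino_det_factor al_beads be_beads nil_l nil_r : D [::] = _.
rewrite sgn_mu.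
have w0 g : fact_weight n g != 0.
  by apply/prodf_neq0 => i _; rewrite invr_eq0 pnatr_eq0 -lt0n fact_gt0.
by apply: cancel_common_factors; rewrite ?signr_eq0.
Qed.
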